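(* Let $f$ be a mixing piecewise expanding $C^3$ unimodal map. Let $X\in C^2(f(I))$ satisfy $X(a)=0$ and $\mathcal J(f,X)=0$, and let $\varphi\in C^1([a,b])$. Let $\alpha$ be the unique bounded function on $I$ with $\alpha(c)=0$ and $X(f(x))=\alpha(f(x))-f'(x)\alpha(x)$ for all $x\in I$, $x\ne c$. Then the number $$\Psi_1=-\sum_{j=1}^{M_f}\varphi(c_j)\sum_{k=1}^{j}\frac{s_1X(c_k)}{(f^{k-1})'(c_1)}-\int(\mathrm{id}-\mathcal L_1)^{-1}\bigl(X'\rho_{sal}+(X\rho_{reg})'\bigr)\varphi\,dx$$ satisfies $$\Psi_1=-\int\alpha\,\varphi\,\rho_{sal}'-\int(\mathrm{id}-\mathcal L_1)^{-1}\bigl(X'\rho_{sal}+(X\rho_{reg})'\bigr)\varphi\,dx .$$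
   Context: Fix $I=[a,b]$, $a<c<b$, $I_+=[a,c]$, $I_-=[c,b]$. For $r\ge1$, a piecewise expanding $C^r$ unimodal map is a continuous $f:I\to I$, strictly increasing on $I_+$, strictly decreasing on $I_-$, with $f(a)=f(b)=a$, such that for $\sigma=\pm$ the map $f|_{I_\sigma}$ extends to a $C^r$ map on a neighbourhood of $I_\sigma$ and $\inf|f'|_{I_\sigma}|>1$. Put $c_k=f^k(c)$. $f$ is mixing if it is topologically mixing on $[f^2(c),f(c)]$. $(f^j)'(x)=\prod_{i<j}f'(f^i(x))$. If $c$ is periodic of minimal period $n_1$ set $N_f=M_f=n_1$. If $c$ is not periodic but some iterate is, let $n_0$ be minimal with $c_{n_0}$ periodic, $n_1$ the minimal period of $c_{n_0}$, and set $N_f=n_0+n_1-1$, $M_f=\infty$. Otherwise $N_f=M_f=\infty$. $\rho_0$ denotes the density (extended by $0$ to $\mathbb R$) of the unique absolutely continuous $f$-invariant probability measure; it has bounded variation. Let $H_u(x)=-1$ for $x<u$, $0$ for $x>u$, $H_u(u)=-1/2$. Then $\rho_0=\rho_{sal}+\rho_{reg}$ with $\rho_{reg}$ continuous and $\rho_{sal}=\sum_{n=1}^{N_f}s_nH_{c_n}$, $s_n=\lim_{y\downarrow c_n}\rho_0(y)-\lim_{x\uparrow c_n}\rho_0(x)$. As a measure $\rho_{sal}'=\sum_{n=1}^{N_f}s_n\delta_{c_n}$. It is known that $\rho_{reg}'$ (a.e. derivative) has bounded variation. $\mathcal J(f,X)=\sum_{n=1}^{N_f}s_nX(c_n)$.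 Note $f(I)=[a,c_1]$; $X$ and $X'$ are set to be $0$ outside $[a,c_1]$ in the products $X'\rho_{sal}$, $(X\rho_{reg})'$. $\mathcal L_1$ is the Perron–Frobenius operator $\mathcal L_1\varphi(x)=\sum_{f(y)=x}\varphi(y)/|f'(y)|$ acting on functions of bounded variation supported in $[a,b]$ (modulo countable sets). Since $f$ is mixing, $\mathcal L_1$ has simple eigenvalue $1$ (eigenvector $\rho_0$, dual eigenvector Lebesgue measure) and the rest of its spectrum lies in a disc of radius $<1$, so on $BV$ functions $g$ with $\int g\,dx=0$ one puts $(\mathrm{id}-\mathcal L_1)^{-1}g=\sum_{j\ge0}\mathcal L_1^jg$. When $\mathcal J(f,X)=0$, $X'\rho_{sal}+(X\rho_{reg})'$ is such a $g$, and it is known that $\Psi_1$ is then a well-defined number. *)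

(* Defs.v *)
From mathcomp Require Import all_boot all_order all_algebra.
From mathcomp Require Import all_classical all_reals all_analysis.

Set Implicit Arguments.
Unset Strict Implicit.
Unset Printing Implicit Defensive.

Import Order.TTheory GRing.Theory Num.Theory.
Import numFieldNormedType.Exports.

Local Open Scope classical_set_scope.
Local Open Scope ring_scope.

(* Maps of an interval [a, b] are total functions R -> R whose values outside
   the interval are never used: every notion below is relative to it. *)

Section Calculus.
Context {R : realType}.
Implicit Types (A U : set R) (f g : R -> R) (x : R).

(* One-sided at the endpoints of an interval A. *)
Definition deriv_in A f x : R :=
  lim ((f y - f x) / (y - x) @[y --> within A x^']).

Definition Ck_open (k : nat) U g : Prop :=
  (forall (j : nat) x, (j < k)%N -> U x -> derivable (derive1n j g) x 1) /\
  (forall x, U x -> {for x, continuous (derive1n k g)}).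

(* C^k on a compact interval A: C^k extension to a neighbourhood of A
   (equivalently, one-sided derivatives at the endpoints). *)
Definition Ck (k : nat) A f : Prop :=
  exists U g, [/\ open U, A `<=` U, Ck_open k U g & forall x, A x -> g x = f x].

Definition rlim f x : R := lim (f y @[y --> x^'+]).
Definition llim f x : R := lim (f y @[y --> x^'-]).

(* Extension of f|_A by 0. *)
Definition zero_ext A f : R -> R := fun x => if x \in A then f x else 0.

Definition heaviside (u x : R) : R :=
  if x < u then -1 else if x == u then - 2^-1 else 0.

(* Sum over 1 <= k <= N, where None stands for N = oo. *)
Definition osum (N : option nat) (u : nat -> R) : R :=
  if N is Some n then \sum_(1 <= k < n.+1) u k else limn (fun n => \sum_(1 <= k < n) u k).

End Calculus.

Section Unimodal.
Context {R : realType}.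
Implicit Types (a b c : R) (f g X phi rho : R -> R).

Record unimodal (r : nat) a c b f : Prop := Unimodal {
  uni_turning    : a < c < b;
  uni_self       : forall x, x \in `[a, b] -> f x \in `[a, b];
  uni_cont       : {within `[a, b], continuous f};
  uni_increasing : forall x y, a <= x -> x < y -> y <= c -> f x < f y;
  uni_decreasing : forall x y, c <= x -> x < y -> y <= b -> f y < f x;
  uni_fa         : f a = a;
  uni_fb         : f b = a;
  uni_Ck_plus    : Ck r `[a, c] f;
  uni_Ck_minus   : Ck r `[c, b] f;
  uni_exp_plus   : 1 < inf [set `|deriv_in `[a, c] f x| | x in `[a, c]];
  uni_exp_minus  : 1 < inf [set `|deriv_in `[c, b] f x| | x in `[c, b]] }.

(* Topological mixing of f on the f-invariant set K. *)
Definition mixing_on (K : set R) f : Prop :=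
  forall U V : set R, open U -> open V -> U `&` K !=set0 -> V `&` K !=set0 ->
    \forall n \near \oo,
      (iter n f @` (U `&` K)) `&` (V `&` K) !=set0.

Definition mixing c f : Prop := mixing_on `[f (f c), f c] f.

(* (f^j)'(x); as f' is undefined at c, this is meaningful only as long as
   x, ..., f^(j-1)(x) avoid c. *)
Definition deriv_iter a b f (j : nat) x : R :=
  \prod_(i < j) deriv_in `[a, b] f (iter i f x).

Definition min_period f x (n : nat) : Prop :=
  [/\ (0 < n)%N, iter n f x = x
    & forall m, (0 < m < n)%N -> iter m f x <> x].

Definition periodic f x : Prop := exists2 n, (0 < n)%N & iter n f x = x.

(* orbit_counts f c N M: N_f = N and M_f = M, with None for oo. *)
Inductive orbit_counts f c : option nat -> option nat -> Prop :=
| Counts_periodic n1 :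
    min_period f c n1 -> orbit_counts f c (Some n1) (Some n1)
| Counts_preperiodic n0 n1 :
    ~ periodic f c ->
    (forall m, (m < n0)%N -> ~ periodic f (iter m f c)) ->
    min_period f (iter n0 f c) n1 ->
    orbit_counts f c (Some (n0 + n1 - 1)%N) None
| Counts_infinite :
    (forall m, ~ periodic f (iter m f c)) -> orbit_counts f c None None.

(* rho is the density of an absolutely continuous f-invariant probability
   measure on [a, b], extended by 0. The last two fields select, in its class
   modulo null sets, the representative of bounded variation whose value at
   each point is the mean of the one-sided limits; this is the normalization
   under which rho_sal + rho_reg = rho holds at every point, given that
   H_u(u) = -1/2. *)
Record invariant_density a b f rho : Prop := InvariantDensity {
  dens_measurable : measurable_fun setT rho;
  dens_ge0        : forall x, 0 <= rho x;
  dens_supp       : forall x, x \notin `[a, b] -> rho x = 0;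
  dens_mass       : (\int[lebesgue_measure]_(x in `[a, b]) (rho x)%:E = 1)%E;
  dens_invariant  : forall A : set R, measurable A ->
    (\int[lebesgue_measure]_(x in `[a, b] `&` f @^-1` A) (rho x)%:E =
     \int[lebesgue_measure]_(x in `[a, b] `&` A) (rho x)%:E)%E;
  dens_BV         : bounded_variation a b rho;
  dens_normalized : forall x, rho x = (llim rho x + rlim rho x) / 2 }.

Section Salient.
Variables (f : R -> R) (c : R) (N : option nat) (rho : R -> R).

Definition jump (n : nat) : R :=
  rlim rho (iter n f c) - llim rho (iter n f c).

Definition rho_sal (x : R) : R :=
  osum N (fun n => jump n * heaviside (iter n f c) x).

Definition rho_reg (x : R) : R := rho x - rho_sal x.

Definition calJ X : R := osum N (fun n => jump n * X (iter n f c)).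

Lemma maxr0_ge0 (r : R) : 0 <= Num.max r 0.
Proof. by rewrite le_max lexx orbT. Qed.

Definition pos_part (r : R) : {nonneg R} := NngNum (maxr0_ge0 r).

(* s_n, made 0 outside 1 <= n <= N. *)
Definition sal_weight (n : nat) : R :=
  if (0 < n)%N && (if N is Some m then (n <= m)%N else true) then jump n else 0.

(* The signed measure rho_sal' = \sum_(1 <= n <= N) s_n delta_(c_n) is
   sal_pos - sal_neg; it is integrated as such. *)
Definition sal_pos : set R -> \bar R :=
  mseries (fun n => mscale (pos_part (sal_weight n)) \d_(iter n f c)) 0.

Definition sal_neg : set R -> \bar R :=
  mseries (fun n => mscale (pos_part (- sal_weight n)) \d_(iter n f c)) 0.

Definition int_sal' (D : set R) (h : R -> R) : R :=
  Rintegral sal_pos D h - Rintegral sal_neg D h.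

End Salient.

(* Perron-Frobenius operator. The value of f' at c is irrelevant: it affects
   transfer f psi only at f c, and functions are considered modulo countable
   sets. *)
Definition transfer a b f (psi : R -> R) : R -> R := fun x =>
  \sum_(y \in `[a, b] `&` f @^-1` [set x]) psi y / `|deriv_in `[a, b] f y|.

(* Pointwise sum of the series \sum_j L_1^j g; when that series converges in
   BV, this is its sum up to a countable set. *)
Definition resolvent a b f g : R -> R := fun x =>
  limn (fun n => \sum_(0 <= j < n) iter j (transfer a b f) g x).

(* X' rho_sal + (X rho_reg)', with X and X' set to 0 outside [a, f c]; the
   derivative of X rho_reg is an a.e. derivative. *)
Definition source a c f (N : option nat) rho X : R -> R := fun x =>
  zero_ext `[a, f c] (deriv_in `[a, f c] X) x * rho_sal f c N rho x
  + derive1 (fun y => zero_ext `[a, f c] X y * rho_reg f c N rho y) x.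

Definition resolvent_term a c b f N rho X phi : R :=
  \int[lebesgue_measure]_(x in `[a, b])
    (resolvent a b f (source a c f N rho X) x * phi x).

Definition Psi1 a c b f (N M : option nat) rho X phi : R :=
  - osum M (fun j => phi (iter j f c) *
      \sum_(1 <= k < j.+1)
         jump f c rho 1 * X (iter k f c) / deriv_iter a b f k.-1 (f c))
  - resolvent_term a c b f N rho X phi.

(* Bounded solution of the twisted cohomological equation with alpha(c) = 0. *)
Definition bounded_tce a c b f X (alpha : R -> R) : Prop :=
  [/\ exists B, forall x, x \in `[a, b] -> `|alpha x| <= B,
      alpha c = 0
    & forall x, x \in `[a, b] -> x != c ->
        X (f x) = alpha (f x) - deriv_in `[a, b] f x * alpha x].

End Unimodal.

(* Main.v *)
(* Both sides share the resolvent term, so the point is that the sum over the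
   critical orbit equals the integral of alpha phi against rho_sal'.

   The distribution function F of rho0 satisfies F x2 - F x1 = 1 - F (f x1) when
   x1 <= c <= x2 have the same image.  Its one-sided derivatives are the one-sided
   limits of rho0, hence the jumps J of rho0 satisfy
   J y = \sum_(f x = y) J x / f' x for y != f c.  Jumps of a function of bounded
   variation are summable and f expands, so J vanishes off the forward orbit of c.
   Along that orbit s_n is therefore sigma_n = s_1 / (f^(n-1))'(c_1), except that
   when c is strictly preperiodic the cycle collects the geometric series of the
   sigma_k over all its passages.

   The twisted equation telescopes: \sum_(k <= j) sigma_k X(c_k) equals
   s_1 (X(c_1) - alpha(c_1)) + sigma_j alpha(c_j).  The hypothesis calJ = 0 kills the
   first term, so the j-th summand of Psi_1 is sigma_j alpha(c_j) phi(c_j). *)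
Require Import Defs.
From mathcomp Require Import all_boot all_order all_algebra.
From mathcomp Require Import all_classical all_reals all_analysis.
From mathcomp Require Import measurable_realfun zify ring lra.
Import Order.TTheory GRing.Theory Num.Theory.
Import numFieldNormedType.Exports.
Local Open Scope classical_set_scope.
Local Open Scope ring_scope.

(** * One-sided limits and jumps of functions of bounded variation *)

Section OneSidedLimits.
Context {R : realType}.
Implicit Types (u v w g : R -> R) (x y z : R).

(** At [x = iter n f c] this is convertible with [jump f c rho n], so facts about jumps at arbitrary
    points apply directly to s_n. *)
Definition jump_at g x : R := rlim g x - llim g x.

Definition regulated g : Prop :=
  forall x, cvg (g y @[y --> x^'+]) /\ cvg (g y @[y --> x^'-]).

Lemma nondecreasing_regulated w : nondecreasing_fun w -> regulated w.
Proof.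
move=> ndw x; split.
- apply: nondecreasing_at_right_is_cvgr.
    by near=> z => p q _ _; exact: ndw.
  near=> z; exists (w x) => _ /= [p + <-]; rewrite in_itv/= => /andP[/ltW xp _].
  exact: ndw.
- apply: nondecreasing_at_left_is_cvgr.
    by near=> z => p q _ _; exact: ndw.
  near=> z; exists (w x) => _ /= [p + <-]; rewrite in_itv/= => /andP[_ /ltW xp].
  exact: ndw.
Unshelve. all: by end_near. Qed.

Lemma rlimP g l x : g y @[y --> x^'+] --> l -> rlim g x = l.
Proof. exact: cvg_lim. Qed.

Lemma llimP g l x : g y @[y --> x^'-] --> l -> llim g x = l.
Proof. exact: cvg_lim. Qed.

Lemma nondecreasing_rlim_ge w x : nondecreasing_fun w -> w x <= rlim w x.
Proof.
move=> ndw; apply: limr_ge; first by case: (nondecreasing_regulated _ ndw x).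
by near=> z; apply: ndw; apply: ltW; near: z; exact: nbhs_right_gt.
Unshelve. all: by end_near. Qed.

Lemma nondecreasing_rlim_le w x z : nondecreasing_fun w -> x < z -> rlim w x <= w z.
Proof.
move=> ndw xz; apply: limr_le; first by case: (nondecreasing_regulated _ ndw x).
by near=> t; apply: ndw; apply: ltW; near: t; exact: nbhs_right_lt.
Unshelve. all: by end_near. Qed.

Lemma nondecreasing_rlim_llim w x y :
  nondecreasing_fun w -> x < y -> rlim w x <= llim w y.
Proof.
move=> ndw xy; apply: limr_ge; first by case: (nondecreasing_regulated _ ndw y).
by near=> z; apply: nondecreasing_rlim_le.
Unshelve. all: by end_near. Qed.

Lemma nondecreasing_jump_ge0 w x : nondecreasing_fun w -> 0 <= jump_at w x.
Proof.
move=> ndw; rewrite /jump_at subr_ge0.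
apply: le_trans (nondecreasing_rlim_ge _ x ndw); apply: limr_le.
  by case: (nondecreasing_regulated _ ndw x).
by near=> z; apply: ndw; apply: ltW; near: z; exact: nbhs_left_lt.
Unshelve. all: by end_near. Qed.

(** The right limit at one point of the list is at most the left limit at the next, so the jumps
    telescope below the total rise. *)
Lemma nondecreasing_sum_jump w x y (s : seq R) : nondecreasing_fun w ->
  x < y -> path <%R x s -> all (< y) s ->
  \sum_(z <- s) jump_at w z <= w y - rlim w x.
Proof.
move=> ndw; elim: s x => [|z s IHs] x xy.
  by rewrite big_nil subr_ge0 => _ _; exact: nondecreasing_rlim_le.
move=> /= /andP[xz zs] /andP[zy sy]; rewrite big_cons.
apply: (le_trans (lerD (lexx _) (IHs _ zy zs sy))).
have := nondecreasing_rlim_llim _ _ _ ndw xz; rewrite /jump_at => h.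
by lra.
Qed.

(** Jordan decomposition. Composing the variation functions with the retraction [clamp] onto
    [[a, b]] makes them monotone on the whole line. *)
Lemma bounded_variation_nondecreasingB {a b g} : a <= b ->
  bounded_variation a b g ->
  exists u v, [/\ nondecreasing_fun u, nondecreasing_fun v &
    {in `[a, b], g =1 u \- v}].
Proof.
move=> ab bvg; pose clamp x := Num.max a (Num.min b x).
have clampP x : clamp x \in `[a, b].
  by rewrite in_itv/= /clamp le_max lexx/= ge_max ab ge_min lexx.
have ndclamp : {homo clamp : x y / x <= y}.
  move=> x y xy; rewrite /clamp ge_max !le_max lexx/=; apply/orP; right.
  by rewrite le_min ge_min lexx/= ge_min xy orbT.
(* [pos_tv] of [g] unfolds to [neg_tv] of [\- g], so one monotonicity lemma serves both
   components. *)
have bvNg : bounded_variation a b (\- g) by exact/bounded_variationN.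
exists (fine \o pos_tv a g \o clamp), (fine \o neg_tv a g \o clamp); split.
- move=> x y xy; exact: (fine_neg_tv_nondecreasing bvNg (clampP x) (clampP y) (ndclamp _ _ xy)).
- move=> x y xy; exact: (fine_neg_tv_nondecreasing bvg (clampP x) (clampP y) (ndclamp _ _ xy)).
- move=> x xab; rewrite (bounded_variation_pos_neg_tvE bvg)//=.
  move: xab; rewrite in_itv/= => /andP[ax xb].
  by rewrite /clamp (min_idPr xb) (max_idPr ax).
Qed.

Section SupportedBV.
Variables (a b : R) (g : R -> R).
Hypotheses (ab : a < b) (bvg : bounded_variation a b g).
Hypothesis (suppg : forall x, x \notin `[a, b] -> g x = 0).

Lemma rlim0 x : (x < a) || (b <= x) -> g y @[y --> x^'+] --> 0.
Proof.
move=> xab; apply: cvg_near_cst; case/orP: xab => [xa|bx]; near=> z;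
  apply: suppg; rewrite in_itv/= negb_and -!ltNge; apply/orP; [left|right].
  by near: z; exact: nbhs_right_lt.
by apply: (le_lt_trans bx).
Unshelve. all: by end_near. Qed.

Lemma llim0 x : (x <= a) || (b < x) -> g y @[y --> x^'-] --> 0.
Proof.
move=> xab; apply: cvg_near_cst; case/orP: xab => [xa|bx]; near=> z;
  apply: suppg; rewrite in_itv/= negb_and -!ltNge; apply/orP; [left|right].
  by apply: lt_le_trans xa.
by near: z; exact: nbhs_left_gt.
Unshelve. all: by end_near. Qed.

Lemma supported_bv_regulated : regulated g.
Proof.
have [u [v [ndu ndv guv]]] := bounded_variation_nondecreasingB (ltW ab) bvg.
have [ru rv] := (nondecreasing_regulated _ ndu, nondecreasing_regulated _ ndv).
move=> x; split.
- have [|/norP] := boolP ((x < a) || (b <= x)).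
    by move/rlim0 => h; apply/cvg_ex; exists 0.
  rewrite -leNgt -ltNge => -[ax xb].
  apply/cvg_ex; exists (rlim u x - rlim v x).
  apply: cvg_trans (cvgB (ru x).1 (rv x).1).
  apply: near_eq_cvg; near=> z; rewrite guv//= in_itv/=; apply/andP; split.
    by apply: (le_trans ax); near: z; exact: nbhs_right_ge.
  by near: z; exact: nbhs_right_le.
- have [|/norP] := boolP ((x <= a) || (b < x)).
    by move/llim0 => h; apply/cvg_ex; exists 0.
  rewrite -leNgt -ltNge => -[ax xb].
  apply/cvg_ex; exists (llim u x - llim v x).
  apply: cvg_trans (cvgB (ru x).2 (rv x).2).
  apply: near_eq_cvg; near=> z; rewrite guv//= in_itv/=; apply/andP; split.
    by near: z; exact: nbhs_left_ge.
  by apply: le_trans xb; near: z; exact: nbhs_left_le.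
Unshelve. all: by end_near. Qed.

(** With [g = u - v] on [[a, b]], each jump of [g] is dominated by that of the nondecreasing
    [w = u + v]. The endpoints are left out since the decomposition says nothing about [g] outside
    [[a, b]]. *)
Lemma bv_jumps_summable : exists V, forall s : seq R, uniq s ->
  {subset s <= `]a, b[} -> \sum_(x <- s) `|jump_at g x| <= V.
Proof.
have [u [v [ndu ndv guv]]] := bounded_variation_nondecreasingB (ltW ab) bvg.
have [ru rv] := (nondecreasing_regulated _ ndu, nondecreasing_regulated _ ndv).
pose w x := u x + v x.
have ndw : nondecreasing_fun w by move=> x y xy; apply: lerD; [exact: ndu|exact: ndv].
have jw x : x \in `]a, b[ -> `|jump_at g x| <= jump_at w x.
  rewrite in_itv/= => /andP[ax xb].
  rewrite /jump_at (rlimP w _ _ (cvgD (ru x).1 (rv x).1)) (llimP w _ _ (cvgD (ru x).2 (rv x).2)).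
  have -> : rlim g x = rlim u x - rlim v x.
    apply: rlimP; apply: cvg_trans (cvgB (ru x).1 (rv x).1).
    apply: near_eq_cvg; near=> z; rewrite guv//= in_itv/=; apply/andP; split.
      by apply: (le_trans (ltW ax)); near: z; exact: nbhs_right_ge.
    by near: z; exact: nbhs_right_le.
  have -> : llim g x = llim u x - llim v x.
    apply: llimP; apply: cvg_trans (cvgB (ru x).2 (rv x).2).
    apply: near_eq_cvg; near=> z; rewrite guv//= in_itv/=; apply/andP; split.
      by near: z; exact: nbhs_left_ge.
    by apply: le_trans (ltW xb); near: z; exact: nbhs_left_le.
  rewrite -!/(rlim _ _) -!/(llim _ _).
  have := nondecreasing_jump_ge0 _ x ndu; have := nondecreasing_jump_ge0 _ x ndv.
  rewrite /jump_at => hv hu.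
  rewrite -[leRHS]/(rlim u x + rlim v x - (llim u x + llim v x)) ler_norml.
  by apply/andP; split; lra.
exists (w b - rlim w a) => s us sab.
rewrite -(perm_big _ (permEl (perm_sort <=%R s))).
apply: (@le_trans _ _ (\sum_(x <- sort <=%R s) jump_at w x)).
  rewrite big_seq_cond [leRHS]big_seq_cond; apply: ler_sum => x.
  by rewrite mem_sort andbT => /sab; exact: jw.
apply: nondecreasing_sum_jump => //.
  rewrite path_min_sorted; first by rewrite lt_sorted_uniq_le sort_uniq us sort_le_sorted.
  by apply/allP => x; rewrite mem_sort => /sab; rewrite in_itv/= => /andP[].
by apply/allP => x; rewrite mem_sort => /sab; rewrite in_itv/= => /andP[].
Unshelve. all: by end_near. Qed.

End SupportedBV.
End OneSidedLimits.

(** * The distribution function of the invariant density *)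

Definition dquot {R : realType} (h : R -> R) (x y : R) : R := (h y - h x) / (y - x).

Section DistributionFunction.
Context {R : realType}.
Notation mu := (@lebesgue_measure R).
Variable g : R -> R.
Hypothesis ig : mu.-integrable setT (EFin \o g).

Definition distr (x : R) : R := \int[mu]_(t in `]-oo, x]) g t.

Let igS (D : set R) : measurable D -> mu.-integrable D (EFin \o g).
Proof. by move=> mD; apply: integrableS ig. Qed.

Lemma distrB x z : x < z -> distr z - distr x = \int[mu]_(t in `]x, z[) g t.
Proof.
move=> xz; rewrite /distr Rintegral_itvB ?bnd_simp ?ltW//; last exact: igS.
by rewrite Rintegral_itv_bndo_bndc//; exact: igS.
Qed.

(** The difference quotient is the mean of [g] over []x, z[], hence lies between the constants
    [l - e] and [l + e]. *)
Lemma distrB_dist_le l e x z : x < z ->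
  (forall t, x < t < z -> `|g t - l| <= e) ->
  `|(distr z - distr x) / (z - x) - l| <= e.
Proof.
move=> xz H; rewrite distrB//.
have mxz : fine (mu `]x, z[) = z - x.
  by rewrite lebesgue_measure_itv/= lte_fin xz.
have zx0 : 0 < z - x by rewrite subr_gt0.
have fxz : (mu `]x, z[ < +oo)%E by rewrite lebesgue_measure_itv/= lte_fin xz ltry.
have ic (k : R) : mu.-integrable `]x, z[ (EFin \o cst k).
  apply: measurable_bounded_integrable => //; exact: bounded_cst.
have cst_int (k : R) : \int[mu]_(t in `]x, z[) k = k * (z - x).
  by rewrite Rintegral_cst// mxz.
rewrite ler_distl; apply/andP; split.
  rewrite ler_pdivlMr// -cst_int; apply: le_Rintegral; [exact: measurable_itv|exact: ic|exact: igS|].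
  by move=> t; rewrite /= in_itv/= => /H; rewrite ler_distl => /andP[].
rewrite ler_pdivrMr// -cst_int; apply: le_Rintegral; [exact: measurable_itv|exact: igS|exact: ic|].
by move=> t; rewrite /= in_itv/= => /H; rewrite ler_distl => /andP[].
Qed.

(** Means over []x, z[] do not see the value [g x], so a one-sided limit of [g] controls the
    one-sided quotient. *)
Lemma distr_rderiv (l x : R) : g t @[t --> x^'+] --> l ->
  dquot distr x @ x^'+ --> l.
Proof.
move=> gl; apply/cvgrPdist_le => e e0.
move/cvgrPdist_le : gl => /(_ e e0) [d /= d0 H].
exists d => //= z; rewrite /ball_/= => xzd xz.
rewrite distrC /dquot; apply: distrB_dist_le => // t /andP[xt tz].
rewrite distrC; apply: H => //=.
rewrite ltr0_norm ?subr_lt0// in xzd; rewrite ltr0_norm ?subr_lt0//.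
by apply: le_lt_trans xzd; lra.
Qed.

Lemma distr_lderiv (l x : R) : g t @[t --> x^'-] --> l ->
  dquot distr x @ x^'- --> l.
Proof.
move=> gl; apply/cvgrPdist_le => e e0.
move/cvgrPdist_le : gl => /(_ e e0) [d /= d0 H].
exists d => //= z; rewrite /ball_/= => xzd zx.
(* Changing both signs gives the quotient over []z, x[], now correctly oriented. *)
rewrite distrC /dquot -[distr z - _]opprB -[z - _]opprB invrN mulrNN.
apply: distrB_dist_le => // t /andP[zt tx].
rewrite distrC; apply: H => //=.
rewrite gtr0_norm ?subr_gt0// in xzd; rewrite gtr0_norm ?subr_gt0//.
by apply: le_lt_trans xzd; lra.
Qed.

End DistributionFunction.

(** * Invariance of the density, read on its distribution function *)

Section InvariantDistribution.
Context {R : realType}.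
Notation mu := (@lebesgue_measure R).
Variables (a c b : R) (f rho : R -> R) (r : nat).
Hypotheses (hf : unimodal r a c b f) (hrho : invariant_density a b f rho).

Lemma density_patch : rho = rho \_ `[a, b].
Proof.
apply/funext => x; rewrite patchE; case: ifPn => // xab.
by rewrite (dens_supp hrho)//; apply: contra xab => ?; rewrite inE.
Qed.

Lemma density_integrable : mu.-integrable setT (EFin \o rho).
Proof.
rewrite density_patch -restrict_EFin; apply/integrable_restrict => //.
rewrite setTI; apply/integrableP; split.
  by apply/measurable_EFinP; apply: measurable_funTS; exact: dens_measurable hrho.
under eq_integral do rewrite /= ger0_norm ?(dens_ge0 hrho)//.
by rewrite (dens_mass hrho) ltry.
Qed.

Let ig (D : set R) : measurable D -> mu.-integrable D (EFin \o rho).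
Proof. by move=> mD; apply: integrableS density_integrable. Qed.

Lemma density_itvI (D : set R) : measurable D ->
  (\int[mu]_(x in `[a, b] `&` D) (rho x)%:E = \int[mu]_(x in D) (rho x)%:E)%E.
Proof.
move=> mD; rewrite [RHS]integral_mkcond [LHS]integral_mkcond; congr integral.
apply/funext => x; rewrite !patchE in_setI.
have [xab|xab] := boolP (x \in `[a, b]%classic) => //=.
rewrite (dens_supp hrho) ?if_same//.
by apply: contra xab => ?; rewrite inE.
Qed.

Lemma distr_tail y : \int[mu]_(t in `]y, +oo[) rho t = 1 - distr rho y.
Proof.
have <- : \int[mu]_(t in `]-oo, +oo[) rho t = 1.
  by rewrite /Rintegral -density_itvI// set_itvNyy setIT (dens_mass hrho).
rewrite /distr Rintegral_itvB ?bnd_simp//; exact: ig.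
Qed.

Lemma unimodal_lt_top x : x \in `[a, b] -> x != c -> f x < f c.
Proof.
rewrite in_itv/= => /andP[ax xb]; rewrite neq_lt => /orP[xc|cx].
  exact: (uni_increasing hf).
exact: (uni_decreasing hf).
Qed.

Lemma unimodal_le_top x : x \in `[a, b] -> f x <= f c.
Proof.
move=> xab; have [->//|xc] := eqVneq x c.
exact/ltW/unimodal_lt_top.
Qed.

(** This turns the preimage of a half-line into an interval, whose mass is a difference of values of
    the distribution function. *)
Lemma unimodal_gt x1 x2 x : a <= x1 <= c -> c <= x2 <= b -> f x1 = f x2 ->
  x \in `[a, b] -> (f x1 < f x) = (x1 < x < x2).
Proof.
move=> /andP[ax1 x1c] /andP[cx2 x2b] f12; rewrite in_itv/= => /andP[ax xb].
have [xc|cx] := leP x c.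
  have [x1x|xx1] := ltP x1 x; last first.
    apply/negbTE; rewrite -leNgt; move: xx1; rewrite le_eqVlt => /orP[/eqP->//|xx1].
    exact/ltW/(uni_increasing hf).
  rewrite (uni_increasing hf)//=; symmetry.
  have [//|x2x] := ltP x x2.
  have xE : x = c by apply/le_anti; rewrite xc (le_trans cx2).
  have x2E : x2 = c by apply/le_anti; rewrite cx2 -xE x2x.
  have := uni_increasing hf ax1 x1x xc.
  by rewrite f12 x2E xE ltxx.
rewrite (le_lt_trans x1c cx)/= f12.
have [xx2|x2x] := ltP x x2.
  by rewrite (uni_decreasing hf)// ltW.
apply/negbTE; rewrite -leNgt; move: x2x; rewrite le_eqVlt => /orP[/eqP->//|x2x].
exact/ltW/(uni_decreasing hf).
Qed.

(** Invariance is applied to []f x1, +oo[], whose preimage is []x1, x2[]. In the degenerate case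
    [x1 = x2 = c] the preimage is empty. *)
Lemma distr_invariant x1 x2 : a <= x1 <= c -> c <= x2 <= b -> f x1 = f x2 ->
  distr rho x2 - distr rho x1 = 1 - distr rho (f x1).
Proof.
move=> h1 h2 f12; have [x12|] := ltP x1 x2; last first.
  move=> x21; move/andP: (h1) => [ax1 x1c]; move/andP: (h2) => [cx2 x2b].
  have x1E : x1 = c by apply/le_anti; rewrite x1c (le_trans cx2).
  have x2E : x2 = c by apply/le_anti; rewrite cx2 (le_trans x21).
  rewrite x1E x2E subrr -distr_tail /Rintegral -density_itvI//.
  rewrite -(dens_invariant hrho)// (_ : _ `&` _ = set0) ?integral_set0//.
  rewrite -subset0 => x [/= xab]; rewrite in_itv/= andbT.
  by rewrite ltNge unimodal_le_top.
rewrite distrB//; last exact: density_integrable.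
rewrite -distr_tail /Rintegral -[in RHS]density_itvI// -(dens_invariant hrho)//.
congr (fine (integral _ _ _)); apply/seteqP; split => x /=.
  rewrite in_itv/= => /andP[x1x xx2].
  have xab : x \in `[a, b].
    move/andP: (h1) => [ax1 x1c]; move/andP: (h2) => [cx2 x2b].
    by rewrite in_itv/= (le_trans ax1 (ltW x1x)) (le_trans (ltW xx2)).
  by split => //; rewrite in_itv/= andbT (unimodal_gt _ _ _ h1 h2 f12)// x1x.
move=> [xab]; rewrite !in_itv/= andbT.
by rewrite (unimodal_gt _ _ _ h1 h2 f12).
Qed.

Lemma distr_top y : f c <= y -> distr rho y = 1.
Proof.
move=> cy; apply/esym/eqP; rewrite -subr_eq0; apply/eqP.
rewrite -distr_tail /Rintegral -density_itvI// -(dens_invariant hrho)//.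
rewrite (_ : _ `&` _ = set0) ?integral_set0//.
rewrite -subset0 => x [/= xab]; rewrite in_itv/= andbT.
by rewrite ltNge (le_trans (unimodal_le_top _ xab)).
Qed.

End InvariantDistribution.

(** * One-sided derivatives of the branches *)

Section OneSidedDerivatives.
Context {R : realType}.
Implicit Types (A B : set R) (h : R -> R) (x p q : R).

Lemma within_itv_at_right p q x : p <= x < q ->
  x^'+ `=>` within `[p, q] x^'.
Proof.
move=> /andP[px xq] P [e /= e0 H].
near=> y; apply: H.
- rewrite /ball_/= ltr0_norm ?subr_lt0//.
  rewrite opprB ltrBlDr; near: y; apply: nbhs_right_lt.
  by rewrite ltrDr.
- by rewrite gt_eqF.
- rewrite /= in_itv/=; apply/andP; split.
    by apply: (le_trans px); exact: ltW.
  by near: y; exact: nbhs_right_le.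
Unshelve. all: by end_near. Qed.

Lemma within_itv_at_left p q x : p < x <= q ->
  x^'- `=>` within `[p, q] x^'.
Proof.
move=> /andP[px xq] P [e /= e0 H].
near=> y; apply: H.
- rewrite /ball_/= gtr0_norm ?subr_gt0//.
  rewrite ltrBlDr -ltrBlDl; near: y; apply: nbhs_left_gt.
  by rewrite ltrBlDr ltrDl.
- by rewrite lt_eqF.
- rewrite /= in_itv/=; apply/andP; split.
    by near: y; exact: nbhs_left_ge.
  by apply: le_trans xq; exact: ltW.
Unshelve. all: by end_near. Qed.

Lemma within_itv_proper p q x : p < q -> x \in `[p, q] ->
  ProperFilter (within `[p, q] x^').
Proof.
move=> pq; rewrite in_itv/= => /andP[px xq]; apply: Build_ProperFilter_ex => P HP.
have [xq'|qx] := ltP x q.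
  have : x^'+ P by apply: (within_itv_at_right p q) => //; rewrite px.
  exact: filter_ex.
have : x^'- P by apply: (within_itv_at_left p q) => //; rewrite xq (lt_le_trans pq).
exact: filter_ex.
Qed.

Lemma derivable_dquot h x : derivable h x 1 ->
  exists l : R, dquot h x @ x^' --> l.
Proof.
move=> /cvg_ex[l hl]; exists l; apply/cvgrPdist_lt => e e0.
move/cvgrPdist_lt : hl => /(_ e e0) [d /= d0 H].
exists d => //= y; rewrite /ball_/= => xyd yx.
have := H (y - x); rewrite /ball_/= sub0r normrN distrC => /(_ xyd).
rewrite subr_eq0 => /(_ yx).
by rewrite /dquot scaler1 subrK -[_ *: _]mulrC.
Qed.

(** The limit is the derivative of the C^k extension, so the same [l] serves every [B] contained in
    [A] near [x]. This is what compares the derivative relative to a branch with the one relative to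
    [[a, b]]. *)
Lemma Ck_dquot k A h x : (0 < k)%N -> Ck k A h -> A x ->
  exists l : R, forall B, (\forall y \near x, B y -> A y) ->
    dquot h x @ (within B x^') --> l.
Proof.
move=> k0 [U [g [oU AU [gU _] gh]]] Ax.
have [l gl] := derivable_dquot _ _ (gU 0 x k0 (AU _ Ax)).
exists l => B BA.
have : dquot g x @ (within B x^') --> l.
  exact: cvg_within_filter.
apply: cvg_trans; apply: near_eq_cvg.
have BA' : \forall y \near x^', B y -> A y by exact: nbhs_dnbhs.
rewrite /prop_near1 /within/=.
by apply: filterS BA' => y BAy By; rewrite /dquot !gh//; exact: BAy.
Qed.

Lemma branch_deriv_in p q A k h x : (0 < k)%N -> p < q -> x \in `[p, q] ->
    Ck k `[p, q] h -> (forall y, y \in `[p, q] -> A y) ->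
    (\forall y \near x, A y -> y \in `[p, q]) ->
  dquot h x @ (within A x^') --> deriv_in A h x /\
  deriv_in A h x = deriv_in `[p, q] h x.
Proof.
move=> k0 pq xpq Ckh pqA Apq.
have [l H] := Ck_dquot _ _ _ _ k0 Ckh xpq.
have PF := within_itv_proper _ _ _ pq xpq.
have PA : ProperFilter (within A x^').
  apply: Build_ProperFilter_ex => P HP.
  have : within `[p, q] x^' P.
    by move: HP; rewrite /within/= => HP; apply: filterS HP => y Py /pqA; exact: Py.
  exact: filter_ex.
have lA : deriv_in A h x = l by apply: cvg_lim => //; exact: H.
have lpq : deriv_in `[p, q] h x = l.
  by apply: cvg_lim => //; apply: H; near=> y.
by split; [rewrite lA; exact: H|rewrite lA].
Unshelve. all: by end_near. Qed.

End OneSidedDerivatives.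

(** * Uniform expansion away from the turning point *)

Section Unimodal.
Context {R : realType}.
Variables (a c b : R) (f : R -> R) (r : nat).
Hypotheses (r0 : (0 < r)%N) (hf : unimodal r a c b f).

Local Notation d := (deriv_in `[a, b] f).

Let ac : a < c. Proof. by case/andP: (uni_turning hf). Qed.
Let cb : c < b. Proof. by case/andP: (uni_turning hf). Qed.

Lemma inf_deriv_in_le (A : set R) h x : A x ->
  inf [set `|deriv_in A h x| | x in A] <= `|deriv_in A h x|.
Proof.
by move=> Ax; apply: ge_inf; [exists 0 => _ [y _ <-]; exact: normr_ge0|exists x].
Qed.

(** Near a point other than [c], [[a, b]] coincides with one of the two branches, so the derivative
    is that of the branch; [lam] is the smaller of the two expansion constants. *)
Lemma unimodal_deriv_expanding : exists2 lam : R, 1 < lam & forall x, x \in `[a, b] -> x != c ->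
  dquot f x @ (within `[a, b] x^') --> d x /\ lam <= `|d x|.
Proof.
exists (Num.min (inf [set `|deriv_in `[a, c] f x| | x in `[a, c]])
  (inf [set `|deriv_in `[c, b] f x| | x in `[c, b]])).
  by rewrite lt_min (uni_exp_plus hf) (uni_exp_minus hf).
move=> x; rewrite in_itv/= => /andP[ax xb]; rewrite neq_lt => /orP[xc|cx].
  have xac : x \in `[a, c] by rewrite in_itv/= ax ltW.
  have [||Hd Ed] := branch_deriv_in a c `[a, b] _ _ _ r0 ac xac (uni_Ck_plus hf).
  - move=> y; rewrite /= !in_itv/= => /andP[-> /le_trans]; apply; exact: ltW.
  - near=> y; rewrite /= !in_itv/= => /andP[-> _]/=; apply: ltW.
    by near: y; exact: lt_nbhsl.
  split=> //; rewrite Ed ge_min; apply/orP; left.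
  exact: inf_deriv_in_le.
have xcb : x \in `[c, b] by rewrite in_itv/= xb ltW.
have [||Hd Ed] := branch_deriv_in c b `[a, b] _ _ _ r0 cb xcb (uni_Ck_minus hf).
- move=> y; rewrite /= !in_itv/= => /andP[cy ->]; rewrite andbT.
  by apply: le_trans cy; exact: ltW.
- near=> y; rewrite /= !in_itv/= => /andP[_ ->]; rewrite andbT; apply: ltW.
  by near: y; exact: lt_nbhsr.
split=> //; rewrite Ed ge_min; apply/orP; right.
exact: inf_deriv_in_le.
Unshelve. all: by end_near. Qed.

End Unimodal.

(** * One-sided limits of the density at the image of a point *)

Lemma cvg_to_at_right {R : realType} {T : Type} (FF : set_system T) {FFF : Filter FF}
    (g : T -> R) (y : R) :
  g @ FF --> y -> (\forall t \near FF, y < g t) -> g @ FF --> y^'+.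
Proof. by move=> gy yg P /gy; apply: filterS2 yg => t /= yt; apply. Qed.

Lemma cvg_to_at_left {R : realType} {T : Type} (FF : set_system T) {FFF : Filter FF}
    (g : T -> R) (y : R) :
  g @ FF --> y -> (\forall t \near FF, g t < y) -> g @ FF --> y^'-.
Proof. by move=> gy yg P /gy; apply: filterS2 yg => t /= yt; apply. Qed.

Section Transfer.
Context {R : realType}.
Variables (a c b : R) (f rho : R -> R) (r : nat).
Hypotheses (r0 : (0 < r)%N) (hf : unimodal r a c b f).
Hypothesis hrho : invariant_density a b f rho.

Local Notation d := (deriv_in `[a, b] f).
Local Notation F := (distr rho).

Let ac : a < c. Proof. by case/andP: (uni_turning hf). Qed.
Let cb : c < b. Proof. by case/andP: (uni_turning hf). Qed.
Let ab : a < b. Proof. exact: lt_trans cb. Qed.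

Lemma unimodal_cvg_right x : a <= x < b -> f @ x^'+ --> f x.
Proof.
move=> /andP[+ xb]; have /continuous_within_itvP := uni_cont hf.
move=> /(_ ab)[fc fa _]; rewrite le_eqVlt => /predU1P[<-//|ax].
by apply: cvg_at_right_filter; apply: fc; rewrite in_itv/= ax.
Qed.

Lemma unimodal_cvg_left x : a < x <= b -> f @ x^'- --> f x.
Proof.
move=> /andP[ax]; have /continuous_within_itvP := uni_cont hf.
move=> /(_ ab)[fc _ fb]; rewrite le_eqVlt => /predU1P[->//|xb].
by apply: cvg_at_left_filter; apply: fc; rewrite in_itv/= ax.
Qed.

Lemma conj_point t : t \in `[a, c] -> exists2 s, s \in `[c, b] & f s = f t.
Proof.
rewrite in_itv/= => /andP[at_ tc].
have tab : t \in `[a, b] by rewrite in_itv/= at_ (le_trans tc (ltW cb)).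
have fba : f b <= f t.
  by rewrite (uni_fb hf); have := uni_self hf tab; rewrite in_itv/= => /andP[].
have ftc := unimodal_le_top _ _ _ _ _ hf _ tab.
apply: IVT; first exact: ltW.
- apply: continuous_subspaceW (uni_cont hf).
  by move=> x; rewrite /= !in_itv/= => /andP[cx ->]; rewrite (le_trans (ltW ac) cx).
- by rewrite ge_min fba orbT le_max ftc.
Qed.

Definition conj_pt t := xget c [set s | s \in `[c, b] /\ f s = f t].

Lemma conj_ptP t : t \in `[a, c] -> conj_pt t \in `[c, b] /\ f (conj_pt t) = f t.
Proof.
move=> /conj_point[s scb fs]; rewrite /conj_pt.
by case: xgetP => [_ -> //|/(_ s)]; case.
Qed.

Lemma unimodal_lt_decr s t : s \in `[c, b] -> t \in `[c, b] -> (f s < f t) = (t < s).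
Proof.
rewrite !in_itv/= => /andP[cs sb] /andP[ct tb].
have [ts|st] := ltP t s; first by rewrite (uni_decreasing hf).
apply/negbTE; rewrite -leNgt; move: st; rewrite le_eqVlt => /predU1P[->//|st].
exact/ltW/(uni_decreasing hf).
Qed.

Lemma unimodal_lt_incr s t : s \in `[a, c] -> t \in `[a, c] -> (f s < f t) = (s < t).
Proof.
rewrite !in_itv/= => /andP[cs sb] /andP[ct tb].
have [ts|st] := ltP s t; first by rewrite (uni_increasing hf).
apply/negbTE; rewrite -leNgt; move: st; rewrite le_eqVlt => /predU1P[->//|st].
exact/ltW/(uni_increasing hf).
Qed.

(** Subtracting two instances of [distr_invariant] gives [F (f t) - F (f x1) = (F t - F x1) - (F
    (conj_pt t) - F x2)], which is divided by the common increment of [f]. The filter stays abstract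
    to cover both one-sided approaches to [x1]. *)
Lemma transfer_limit (FF : set_system R) {PFF : ProperFilter FF}
    (x1 x2 s s1 s2 d1 d2 : R) :
  x1 \in `[a, c] -> x2 \in `[c, b] -> f x1 = f x2 ->
  (\forall t \near FF, [/\ t \in `[a, c], t != x1 & conj_pt t != x2]) ->
  dquot F x1 t @[t --> FF] --> s1 ->
  dquot F x2 (conj_pt t) @[t --> FF] --> s2 ->
  dquot F (f x1) (f t) @[t --> FF] --> s ->
  dquot f x1 t @[t --> FF] --> d1 ->
  dquot f x2 (conj_pt t) @[t --> FF] --> d2 ->
  d1 != 0 -> d2 != 0 -> s = s1 / d1 - s2 / d2.
Proof.
move=> hx1 hx2 f12 H c1 c2 cs cd1 cd2 d10 d20.
rewrite -(cvg_lim (@Rhausdorff R) cs); apply: cvg_lim; first exact: Rhausdorff.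
apply: cvg_trans (cvgB (cvgM c1 (cvgV d10 cd1)) (cvgM c2 (cvgV d20 cd2))).
apply: near_eq_cvg; apply: filterS H => t [tac tx1 tx2].
have [tcb ft] := conj_ptP _ tac.
have := distr_invariant _ _ _ _ _ _ hf hrho t (conj_pt t).
rewrite -!/(in_mem _ _) => /(_ _ _ (esym ft)) Ht.
have := distr_invariant _ _ _ _ _ _ hf hrho x1 x2.
move=> /(_ _ _ f12) H12.
move: tac tcb hx1 hx2; rewrite !in_itv/= => tac tcb hx1 hx2.
have {}Ht := Ht tac tcb; have {}H12 := H12 hx1 hx2.
have fne : f t - f x1 != 0.
  rewrite subr_eq0; apply/eqP => E.
  have := unimodal_lt_incr t x1; have := unimodal_lt_incr x1 t; rewrite !in_itv/= E ltxx.
  move=> /(_ hx1 tac) A /(_ tac hx1) B.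
  by move: tx1; rewrite neq_lt -A -B.
have tn : t - x1 != 0 by rewrite subr_eq0.
have un : conj_pt t - x2 != 0 by rewrite subr_eq0.
suff : dquot F x1 t / dquot f x1 t - dquot F x2 (conj_pt t) / dquot f x2 (conj_pt t)
    = dquot F (f x1) (f t) by [].
rewrite /dquot ft -f12.
have -> : F (f t) - F (f x1) = (F t - F x1) - (F (conj_pt t) - F x2) by lra.
by field; rewrite fne tn un.
Qed.

(** As [t] decreases to [x1], [f t] decreases to [f x1] while [conj_pt t] increases to [x2]: hence
    the left limit at [x2]. The minus sign makes up for the negative slope [d x2]. *)
Lemma rlim_transfer x1 x2 : a <= x1 < c -> c < x2 <= b -> f x1 = f x2 ->
  rlim rho (f x1) = rlim rho x1 / d x1 - llim rho x2 / d x2.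
Proof.
move=> /andP[ax1 x1c] /andP[cx2 x2b] f12.
have x1ac : x1 \in `[a, c] by rewrite in_itv/= ax1 ltW.
have x2cb : x2 \in `[c, b] by rewrite in_itv/= x2b ltW.
have x1ab : x1 \in `[a, b] by rewrite in_itv/= ax1 ltW// (lt_trans x1c).
have x2ab : x2 \in `[a, b] by rewrite in_itv/= x2b ltW// (lt_trans ac).
have reg := supported_bv_regulated a b rho ab (dens_BV hrho) (dens_supp hrho).
have ig := density_integrable _ _ _ _ hrho.
have [lam lam1 Hd] := unimodal_deriv_expanding _ _ _ _ _ r0 hf.
have [D1 l1] := Hd x1 x1ab (negbT (lt_eqF x1c)).
have [D2 l2] := Hd x2 x2ab (negbT (gt_eqF cx2)).
have d1 : d x1 != 0 by rewrite -normr_gt0; apply: lt_le_trans l1; lra.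
have d2 : d x2 != 0 by rewrite -normr_gt0; apply: lt_le_trans l2; lra.
have tac : \forall t \near x1^'+, t \in `[a, c].
  near=> t; rewrite in_itv/=; apply/andP; split; first by apply: (le_trans ax1); exact: ltW.
  by near: t; exact: nbhs_right_le.
have fcvg : f @ x1^'+ --> f x1 by apply: unimodal_cvg_right; rewrite ax1 (lt_trans x1c).
have flt : \forall t \near x1^'+, f x1 < f t.
  by apply: filterS2 tac (nbhs_right_gt x1) => t tac; rewrite unimodal_lt_incr.
have fcvgR : f @ x1^'+ --> (f x1)^'+ by exact: cvg_to_at_right.
have ult : \forall t \near x1^'+, conj_pt t < x2.
  apply: filterS2 tac flt => t tac; have [ucb fu] := conj_ptP _ tac.
  by rewrite -fu f12 unimodal_lt_decr.
have ucvg : conj_pt @ x1^'+ --> x2^'-.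
  apply: cvg_to_at_left => //; apply/cvgrPdist_le => e e0.
  (* Since [f] decreases on [[c, b]], [f t < f s] forces [conj_pt t > s], hence within [e] of [x2];
     the maximum keeps [s] in that branch. *)
  pose s := Num.max c (x2 - e).
  have sx2 : s < x2 by rewrite /s gt_max cx2/= ltrBlDr ltrDl.
  have scb : s \in `[c, b].
    by rewrite in_itv/= /s le_max lexx/=; apply: le_trans x2b; exact: ltW.
  have fs : f x1 < f s by rewrite f12 unimodal_lt_decr.
  have fts : \forall t \near x1^'+, f t < f s.
    by move/cvgr_lt : fcvg; apply.
  apply: filterS3 tac fts ult => t tac fts ux.
  have [ucb fu] := conj_ptP _ tac; move: fts; rewrite -fu unimodal_lt_decr//.
  rewrite /s gt_max => /andP[_ h]; rewrite ger0_norm ?subr_ge0 ?(ltW ux)//; lra.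
apply: (transfer_limit x1^'+ x1 x2 _ _ _ _ _ x1ac x2cb f12 _ _ _ _ _ _ d1 d2).
- apply: filterS3 tac ult (nbhs_right_gt x1) => t tac ux xt.
  by rewrite tac gt_eqF// lt_eqF.
- exact: (distr_rderiv _ ig _ _ (reg x1).1).
- apply: (@cvg_comp _ _ _ conj_pt (dquot F x2) _ _ _ ucvg).
  exact: (distr_lderiv _ ig _ _ (reg x2).2).
- apply: (@cvg_comp _ _ _ f (dquot F (f x1)) _ _ _ fcvgR).
  exact: (distr_rderiv _ ig _ _ (reg _).1).
- apply: cvg_trans D1; apply: cvg_app; apply: within_itv_at_right.
  by rewrite ax1 (lt_trans x1c).
- apply: (@cvg_comp _ _ _ conj_pt (dquot f x2) _ _ _ ucvg).
  apply: cvg_trans D2; apply: cvg_app; apply: within_itv_at_left.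
  by rewrite x2b (lt_trans ac).
Unshelve. all: by end_near. Qed.

(** Mirror image of [rlim_transfer]. Both points are interior because [t] approaches [x1] from below
    and [conj_pt t] approaches [x2] from above. *)
Lemma llim_transfer x1 x2 : a < x1 < c -> c < x2 < b -> f x1 = f x2 ->
  llim rho (f x1) = llim rho x1 / d x1 - rlim rho x2 / d x2.
Proof.
move=> /andP[ax1 x1c] /andP[cx2 x2b] f12.
have x1ac : x1 \in `[a, c] by rewrite in_itv/= !ltW.
have x2cb : x2 \in `[c, b] by rewrite in_itv/= !ltW.
have x1ab : x1 \in `[a, b] by rewrite in_itv/= ltW//= ltW// (lt_trans x1c).
have x2ab : x2 \in `[a, b] by rewrite in_itv/= ltW/= ?ltW// (lt_trans ac).
have reg := supported_bv_regulated a b rho ab (dens_BV hrho) (dens_supp hrho).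
have ig := density_integrable _ _ _ _ hrho.
have [lam lam1 Hd] := unimodal_deriv_expanding _ _ _ _ _ r0 hf.
have [D1 l1] := Hd x1 x1ab (negbT (lt_eqF x1c)).
have [D2 l2] := Hd x2 x2ab (negbT (gt_eqF cx2)).
have d1 : d x1 != 0 by rewrite -normr_gt0; apply: lt_le_trans l1; lra.
have d2 : d x2 != 0 by rewrite -normr_gt0; apply: lt_le_trans l2; lra.
have tac : \forall t \near x1^'-, t \in `[a, c].
  near=> t; rewrite in_itv/=; apply/andP; split; last by apply: le_trans (ltW x1c); exact: ltW.
  by near: t; exact: nbhs_left_ge.
have fcvg : f @ x1^'- --> f x1 by apply: unimodal_cvg_left; rewrite ax1 ltW// (lt_trans x1c).
have flt : \forall t \near x1^'-, f t < f x1.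
  by apply: filterS2 tac (nbhs_left_lt x1) => t tac; rewrite unimodal_lt_incr.
have fcvgR : f @ x1^'- --> (f x1)^'- by exact: cvg_to_at_left.
have ult : \forall t \near x1^'-, x2 < conj_pt t.
  apply: filterS2 tac flt => t tac; have [ucb fu] := conj_ptP _ tac.
  by rewrite -fu f12 unimodal_lt_decr.
have ucvg : conj_pt @ x1^'- --> x2^'+.
  apply: cvg_to_at_right => //; apply/cvgrPdist_le => e e0.
  pose s := Num.min b (x2 + e).
  have sx2 : x2 < s by rewrite /s lt_min x2b/= ltrDl.
  have scb : s \in `[c, b].
    by rewrite in_itv/= /s ge_min lexx/= andbT; apply: (le_trans (ltW cx2)); exact: ltW.
  have fs : f s < f x1 by rewrite f12 unimodal_lt_decr.
  have fts : \forall t \near x1^'-, f s < f t.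
    by move/cvgr_gt : fcvg; apply.
  apply: filterS3 tac fts ult => t tac fts ux.
  have [ucb fu] := conj_ptP _ tac; move: fts; rewrite -fu unimodal_lt_decr//.
  rewrite /s lt_min => /andP[_ h]; rewrite ler0_norm ?subr_le0 ?(ltW ux)//; lra.
apply: (transfer_limit x1^'- x1 x2 _ _ _ _ _ x1ac x2cb f12 _ _ _ _ _ _ d1 d2).
- apply: filterS3 tac ult (nbhs_left_lt x1) => t tac ux xt.
  by rewrite tac lt_eqF// gt_eqF.
- exact: (distr_lderiv _ ig _ _ (reg x1).2).
- apply: (@cvg_comp _ _ _ conj_pt (dquot F x2) _ _ _ ucvg).
  exact: (distr_rderiv _ ig _ _ (reg x2).1).
- apply: (@cvg_comp _ _ _ f (dquot F (f x1)) _ _ _ fcvgR).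
  exact: (distr_lderiv _ ig _ _ (reg _).2).
- apply: cvg_trans D1; apply: cvg_app; apply: within_itv_at_left.
  by rewrite ax1 ltW// (lt_trans x1c).
- apply: (@cvg_comp _ _ _ conj_pt (dquot f x2) _ _ _ ucvg).
  apply: cvg_trans D2; apply: cvg_app; apply: within_itv_at_right.
  by rewrite x2b ltW// (lt_trans ac).
Unshelve. all: by end_near. Qed.

End Transfer.

(** * Jumps off the postcritical orbit *)

(* The supremum T of the finite sums of g over S satisfies lam * T <= T. *)
Lemma summable_expanded_eq0 {R : realType} (S : set R) (g : R -> R) (lam V : R) :
  1 < lam -> (forall x, 0 <= g x) ->
  (forall s : seq R, uniq s -> (forall x, x \in s -> S x) -> \sum_(x <- s) g x <= V) ->
  (forall s : seq R, uniq s -> (forall x, x \in s -> S x) ->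
    exists s' : seq R, [/\ uniq s', forall x, x \in s' -> S x &
      lam * \sum_(x <- s) g x <= \sum_(x <- s') g x]) ->
  forall x, S x -> g x = 0.
Proof.
move=> lam1 g0 gV gE x Sx.
pose T := [set t : R | exists s : seq R,
  [/\ uniq s, forall x, x \in s -> S x & t = \sum_(x <- s) g x]].
have Tx : T (g x).
  by exists [:: x]; split=> //; [move=> y; rewrite inE => /eqP->|rewrite big_seq1].
have ubT : has_ubound T by exists V => _ [s [us sS ->]]; exact: gV.
have xT : g x <= sup T by exact: ub_le_sup.
have : sup T <= sup T / lam.
  apply: ge_sup; first by exists (g x).
  move=> _ [s [us sS ->]]; rewrite ler_pdivlMr ?(lt_trans _ lam1)// mulrC.
  have [s' [us' sS' le_ss']] := gE s us sS.
  by apply: (le_trans le_ss'); apply: ub_le_sup => //; exists s'.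
rewrite ler_pdivlMr ?(lt_trans _ lam1)// => Tlam.
by apply: le_anti; rewrite g0 andbT (le_trans xT)//; nra.
Qed.

Section Jumps.
Context {R : realType}.
Variables (a c b : R) (f rho : R -> R) (r : nat).
Hypotheses (r0 : (0 < r)%N) (hf : unimodal r a c b f).
Hypothesis hrho : invariant_density a b f rho.

Local Notation d := (deriv_in `[a, b] f).
Local Notation J := (jump_at rho).

Let ac : a < c. Proof. by case/andP: (uni_turning hf). Qed.
Let cb : c < b. Proof. by case/andP: (uni_turning hf). Qed.
Let ab : a < b. Proof. exact: lt_trans cb. Qed.

(** For interior points the two limit formulas are subtracted. Otherwise [x1 = a], [x2 = b] and
    [f x1 = a], and the limits of [rho] taken from outside [[a, b]] vanish. *)
Lemma jump_transfer x1 x2 : a <= x1 < c -> c < x2 <= b -> f x1 = f x2 ->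
  J (f x1) = J x1 / d x1 + J x2 / d x2.
Proof.
move=> h1 h2 f12; have Hr := rlim_transfer _ _ _ _ _ _ r0 hf hrho _ _ h1 h2 f12.
have supp := dens_supp hrho.
move/andP: (h1) => [+ x1c]; move/andP: (h2) => [cx2 x2b].
rewrite le_eqVlt => /predU1P[x1a|ax1].
  have x2E : x2 = b.
    apply/eqP; apply: contraTT isT => x2b'.
    have : f b < f x2 by apply: (uni_decreasing hf) => //; [exact: ltW|rewrite lt_neqAle x2b'].
    by rewrite -f12 -x1a (uni_fa hf) (uni_fb hf) ltxx.
  rewrite /jump_at Hr -x1a x2E (uni_fa hf).
  rewrite (llimP rho 0 a) ?(rlimP rho 0 b); first by rewrite !subr0 sub0r mulNr.
    by apply: (rlim0 a b) => //; rewrite lexx orbT.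
  by apply: (llim0 a b) => //; rewrite lexx.
have x2b' : x2 < b.
  rewrite lt_neqAle x2b andbT; apply/eqP => E.
  have : f a < f x1 by apply: (uni_increasing hf) => //; exact: ltW.
  by rewrite f12 E (uni_fa hf) (uni_fb hf) ltxx.
rewrite /jump_at Hr (llim_transfer _ _ _ _ _ _ r0 hf hrho _ _ _ _ f12) ?ax1 ?cx2//.
rewrite !mulrBl; move: (_ / d x1) (_ / d x1) (_ / d x2) (_ / d x2) => A1 A2 A3 A4; ring.
Qed.

(** The distribution function is constant from [f c] on, so its one-sided derivatives, which are the
    one-sided limits of [rho], vanish at [y]. *)
Lemma jump_above_top y : f c < y -> J y = 0.
Proof.
move=> cy; have reg := supported_bv_regulated a b rho ab (dens_BV hrho) (dens_supp hrho).
have ig := density_integrable _ _ _ _ hrho.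
have D0 z : f c <= z -> dquot (distr rho) y z = 0.
  by move=> cz; rewrite /dquot !(distr_top _ _ _ _ _ _ hf hrho) ?subrr ?mul0r// ltW.
have Er : rlim rho y = 0.
  rewrite /rlim -(cvg_lim (@Rhausdorff R) (distr_rderiv _ ig _ _ (reg y).1)).
  apply: cvg_lim; first exact: Rhausdorff.
  apply: cvg_near_cst; near=> z; apply: D0.
  by rewrite (le_trans (ltW cy))//; exact: ltW.
have El : llim rho y = 0.
  rewrite /llim -(cvg_lim (@Rhausdorff R) (distr_lderiv _ ig _ _ (reg y).2)).
  apply: cvg_lim; first exact: Rhausdorff.
  apply: cvg_near_cst; near=> z; apply: D0.
  by near: z; exact: nbhs_left_ge.
by rewrite /jump_at Er El subrr.
Unshelve. all: by end_near. Qed.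

Lemma unimodal_preimages y : a <= y < f c ->
  exists x1 x2, [/\ a <= x1 < c, c < x2 <= b, f x1 = y & f x2 = y].
Proof.
move=> /andP[ay yc].
have [x1 + fx1] : exists2 x, x \in `[a, c] & f x = y.
  apply: IVT; first exact: ltW.
    apply: continuous_subspaceW (uni_cont hf) => x; rewrite /= !in_itv/= => /andP[-> /le_trans].
    by apply; exact: ltW.
  by rewrite ge_min (uni_fa hf) ay le_max (ltW yc) orbT.
have [x2 + fx2] : exists2 x, x \in `[c, b] & f x = y.
  apply: IVT; first exact: ltW.
    apply: continuous_subspaceW (uni_cont hf) => x; rewrite /= !in_itv/= => /andP[cx ->].
    by rewrite (le_trans (ltW ac) cx).
  by rewrite ge_min (uni_fb hf) ay orbT le_max (ltW yc).
rewrite !in_itv/= => /andP[cx2 x2b] /andP[ax1 x1c].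
exists x1, x2; split => //.
  rewrite ax1 lt_neqAle x1c andbT; apply/eqP => E.
  by move: yc; rewrite -fx1 E ltxx.
rewrite x2b lt_neqAle cx2 !andbT; apply/eqP => E.
by move: yc; rewrite -fx2 -E ltxx.
Qed.

(** Iterates start at [1], so [c] itself is postcritical only when it is periodic. *)
Definition postcritical y := exists2 k, (0 < k)%N & iter k f c = y.

Lemma postcritical_image x : x = c \/ postcritical x -> postcritical (f x).
Proof. by case=> [->|[k k0 <-]]; [exists 1%N|exists k.+1]. Qed.

(** Points above [f c] carry no jump. Replacing each other point of a finite list by its two
    preimages multiplies the total of the absolute jumps by at least [lam], by [jump_transfer], and
    stays among interior non-postcritical points. Summability then forces all these jumps to
    vanish. *)
Lemma jump_interior y : y \in `]a, b[ -> ~ postcritical y -> J y = 0.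
Proof.
move=> yab npy; apply/eqP; rewrite -normr_eq0; apply/eqP.
pose S : set R := fun y => (y \in `]a, b[) /\ ~ postcritical y.
have [V HV] := bv_jumps_summable a b rho ab (dens_BV hrho).
have [lam lam1 Hd] := unimodal_deriv_expanding _ _ _ _ _ r0 hf.
apply: (summable_expanded_eq0 S (fun x => `|J x|) lam V lam1) => //.
  by move=> s us sS; apply: HV => // x /sS[].
(* The induction also records that [f] sends [s'] into [s]: preimages of a new point [z] then cannot
   already occur in [s']. *)
move=> s; suff H : uniq s -> (forall x, x \in s -> S x) ->
    exists s' : seq R, [/\ uniq s', (forall x, x \in s' -> S x /\ f x \in s) &
      lam * \sum_(x <- s) `|J x| <= \sum_(x <- s') `|J x|].
  move=> us sS; have [s' [us' sS' le_s]] := H us sS; exists s'; split => // x /sS'[]//.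
elim: s => [|z s IHs]; first by exists [::]; split => //; rewrite !big_nil mulr0.
move=> /= /andP[zs us] sS.
have [|s' [us' sS' le_s]] := IHs us; first by move=> x xs; apply: sS; rewrite inE xs orbT.
have [zab npz] : S z by apply: sS; rewrite inE eqxx.
have [zc|] := ltP z (f c); last first.
  rewrite le_eqVlt => /predU1P[zE|cz].
    by exfalso; apply: npz; exists 1%N.
  exists s'; split => //; first by move=> x /sS'[Sx fxs]; rewrite inE fxs orbT.
  by rewrite big_cons jump_above_top// normr0 add0r.
have [|x1 [x2 [hx1 hx2 fx1 fx2]]] := unimodal_preimages z.
  by move: zab; rewrite in_itv/= => /andP[/ltW-> _].
have x1ab : x1 \in `[a, b].
  by move/andP: hx1 => [ax1 x1c]; rewrite in_itv/= ax1 ltW// (lt_trans x1c).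
have x2ab : x2 \in `[a, b].
  by move/andP: hx2 => [cx2 x2b]; rewrite in_itv/= x2b ltW// (lt_trans ac).
have x1c : x1 != c by case/andP: hx1 => _ h; rewrite lt_eqF.
have x2c : x2 != c by case/andP: hx2 => h _; rewrite gt_eqF.
have x12 : x1 != x2.
  by case/andP: hx1 => _ h; case/andP: hx2 => h' _; rewrite lt_eqF// (lt_trans h).
(* Both endpoints map to [a < z], so neither is a preimage of [z]. *)
have inS x : x \in `[a, b] -> f x = z -> S x.
  move=> xab fx; split.
    have az : f a < z by rewrite (uni_fa hf); move: zab; rewrite in_itv/= => /andP[].
    move: xab; rewrite !in_itv/= !le_eqVlt => /andP[/predU1P[xa|->]].
      by move: az; rewrite -fx -xa ltxx.
    case/predU1P => [xb|->//].
    by move: az; rewrite -fx xb (uni_fa hf) (uni_fb hf) ltxx.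
  by move=> px; apply: npz; rewrite -fx; apply: postcritical_image; right.
have nin x : f x = z -> x \notin s'.
  by move=> fx; apply: contra zs => /sS'[_]; rewrite fx.
exists [:: x1, x2 & s']; split.
- by rewrite /= inE negb_or x12 !nin.
- move=> x; rewrite !inE => /or3P[/eqP->|/eqP->|xs'].
  + by rewrite fx1 eqxx; split => //; exact: inS.
  + by rewrite fx2 eqxx; split => //; exact: inS.
  + by have [Sx fxs] := sS' _ xs'; rewrite fxs orbT.
rewrite !big_cons mulrDr addrA; apply: lerD => //.
have [_ l1] := Hd _ x1ab x1c; have [_ l2] := Hd _ x2ab x2c.
have lam0 : 0 < lam by exact: lt_trans lam1.
have d1 : 0 < `|d x1| by exact: lt_le_trans l1.
have d2 : 0 < `|d x2| by exact: lt_le_trans l2.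
rewrite -{1}fx1 (jump_transfer _ _ hx1 hx2) ?fx1//.
rewrite mulrC -ler_pdivlMr// [leRHS]mulrDl; apply: (le_trans (ler_normD _ _)).
by apply: lerD; rewrite normrM normfV ler_wpM2l// lef_pV2.
Qed.

(** Only the endpoints remain. Either [b] lies above [f c], or it equals [f c] and is postcritical.
    At the fixed point [a] the other preimage is [b], so [J a = J a / d a] with a slope of modulus
    above 1. *)
Lemma jump_not_postcritical y : y \in `[a, b] -> ~ postcritical y -> J y = 0.
Proof.
move=> yab npy.
have Jb : ~ postcritical b -> J b = 0.
  move=> npb; apply: jump_above_top; rewrite lt_neqAle.
  have cab : c \in `[a, b] by rewrite in_itv/= !ltW.
  have := uni_self hf cab; rewrite in_itv/= => /andP[_ ->].
  by rewrite andbT; apply/eqP => E; apply: npb; exists 1%N.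
have [yb|yb] := eqVneq y b; first by rewrite yb; apply: Jb; rewrite -yb.
have [ya|ya] := eqVneq y a; last first.
  apply: jump_interior => //; move: yab; rewrite !in_itv/= !le_eqVlt.
  by rewrite (negbTE yb) eq_sym (negbTE ya).
have npb : ~ postcritical b.
  by move=> pb; apply: npy; rewrite ya -(uni_fb hf); apply: postcritical_image; right.
have := jump_transfer a b; rewrite lexx ac cb lexx (uni_fa hf) (uni_fb hf).
move=> /(_ isT isT erefl); rewrite (Jb npb) mul0r addr0 => E.
have [lam lam1 Hd] := unimodal_deriv_expanding _ _ _ _ _ r0 hf.
have aab : a \in `[a, b] by rewrite in_itv/= lexx ltW.
have [_ l1] := Hd _ aab (negbT (lt_eqF ac)).
have d0 : d a != 0 by rewrite -normr_gt0; apply: lt_le_trans l1; exact: lt_trans lam1.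
have d1 : d a - 1 != 0.
  by rewrite subr_eq0; apply/eqP => d1; move: l1; rewrite d1 normr1 leNgt lam1.
rewrite ya; apply/eqP; have : J a * (d a - 1) = 0.
  by rewrite mulrBr mulr1 {1}E mulfVK// subrr.
by move/eqP; rewrite mulf_eq0 (negbTE d1) orbF.
Qed.

End Jumps.

(** * Integration against a series of Dirac masses *)

Section DiracSeries.
Import HBNNSimple.
Context {R : realType}.
Variables (w : nat -> {nonneg R}) (x : nat -> R) (D : set R).
Hypotheses (mD : measurable D) (Dx : forall n, D (x n)).

Let m : set R -> \bar R := mseries (fun n => mscale (w n) \d_(x n)) 0.

(** Holds for arbitrary nonnegative functions, the integral being a supremum over simple functions
    below. This generality matters because [alpha] is only known to be bounded. *)
Lemma ge0_le_integral_lower (mu : {measure set R -> \bar R}) (k1 k2 : R -> \bar R) :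
  (forall t, 0 <= k1 t)%E -> (forall t, k1 t <= k2 t)%E ->
  (\int[mu]_(t in D) k1 t <= \int[mu]_(t in D) k2 t)%E.
Proof.
move=> k10 k12.
have k20 t : (0 <= k2 t)%E by exact: le_trans (k12 t).
rewrite !ge0_integralE//; apply: ge_ereal_sup => _ [g /= gk] <-.
apply: ereal_sup_ubound; exists g => //= t; apply: (le_trans (gk t)).
by rewrite !patchE; case: ifPn.
Qed.

(* No measurability of k: the integral is a supremum over simple functions, and k
   may be replaced by its restriction to the countable support. *)
Lemma ge0_integral_dirac_series (k : R -> \bar R) : (forall t, 0 <= k t)%E ->
  (\int[m]_(t in D) k t = \sum_(n <oo) (w n)%:num%:E * k (x n))%E.
Proof.
move=> k0.
have dE n (g : R -> \bar R) : (forall t, 0 <= g t)%E -> measurable_fun D g ->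
    (\int[mscale (w n) \d_(x n)]_(t in D) g t = (w n)%:num%:E * g (x n))%E.
  move=> g0 mg; rewrite ge0_integral_mscale//.
  rewrite integral_dirac// diracE mem_set ?mul1e//; exact: Dx.
apply/le_anti/andP; split.
  (* Upper bound: a simple function below [k] integrates term by term, and its value at [x n] is at
     most [k (x n)]. *)
  rewrite ge0_integralE//; apply: ge_ereal_sup => _ [g /= gk] <-.
  rewrite -integralT_nnsfun (integral_measure_series_nnsfun _ mD).
  apply: lee_nneseries => n _.
    by move=> _; apply: integral_ge0 => t _; rewrite lee_fin.
  rewrite ge0_integral_mscale//; last 2 first.
    exact/measurable_EFinP.
  by move=> t _; rewrite lee_fin.
  rewrite integral_dirac//; last exact/measurable_EFinP.
  rewrite diracT mul1e; apply: lee_wpmul2l; first by rewrite lee_fin.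
  by have := gk (x n); rewrite patchE mem_set.
(* Lower bound: every subset of the countable [C] is measurable, hence so is [k \_ C], which agrees
   with [k] at each [x n]. *)
pose C := range x.
have mk : measurable_fun setT (k \_ C).
  apply/(measurable_restrictT _ (D := C)).
    apply: countable_measurable; first exact: measurable_set1.
    exact: card_image_le.
  move=> _ B mB; apply: countable_measurable; first exact: measurable_set1.
  apply: (@sub_countable _ _ _ C); last exact: card_image_le.
  by apply: subset_card_le => t [].
have kC0 t : (0 <= (k \_ C) t)%E by rewrite patchE; case: ifP.
apply: (@le_trans _ _ (\int[m]_(t in D) (k \_ C) t)%E); last first.
  apply: ge0_le_integral_lower => // t; rewrite patchE; case: ifP => _.
    exact: lexx.
  exact: k0.
rewrite ge0_integral_measure_series//; last exact: measurable_funTS.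
apply: lee_nneseries => n _; first by move=> _; apply: mule_ge0 => //; rewrite lee_fin.
by rewrite dE//; [rewrite patchE mem_set//; exists n|exact: measurable_funTS].
Qed.

(** The positive and negative parts of [h] are integrated separately; bounded values at the [x n]
    and summable weights make both integrals finite, so their difference is meaningful. *)
Lemma Rintegral_dirac_series (h : R -> R) (B : R) :
  (forall n, `|h (x n)| <= B) -> cvgn (series (fun n => (w n)%:num)) ->
  series (fun n => (w n)%:num * h (x n)) @ \oo --> Rintegral m D h.
Proof.
move=> hB cw.
have part (g : R -> R) : (forall t, 0 <= g t) -> (forall n, g (x n) <= B) ->
    exists2 l : R, series (fun n => (w n)%:num * g (x n)) @ \oo --> l &
      (\int[m]_(t in D) (g t)%:E = l%:E)%E.
  move=> g0 gB.
  have cg : cvgn (series (fun n => (w n)%:num * g (x n))).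
    apply: (@series_le_cvg _ _ (fun n => B * (w n)%:num)).
    - by move=> n; apply: mulr_ge0.
    - by move=> n; apply: mulr_ge0 => //; exact: le_trans (gB n).
    - by move=> n; rewrite mulrC ler_wpM2r.
    - exact: is_cvg_seriesZ.
  exists (limn (series (fun n => (w n)%:num * g (x n)))) => //.
  rewrite (ge0_integral_dirac_series (EFin \o g)) => [|t]; last by rewrite lee_fin.
  rewrite -EFin_lim//; congr (limn _); apply/funext => n.
  by rewrite /= -sumEFin.
have [|l1 h1 E1] := part (h^\+)%R (funrpos_ge0 h).
  move=> n; apply: le_trans (hB n).
  by rewrite /funrpos ge_max ler_norm normr_ge0.
have [|l2 h2 E2] := part (h^\-)%R (funrneg_ge0 h).
  move=> n; apply: le_trans (hB n).
  by rewrite /funrneg ge_max ler_normlW ?normrN// normr_ge0.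
have -> : Rintegral m D h = l1 - l2.
  rewrite /Rintegral integralE (_ : l1 - l2 = fine (l1%:E - l2%:E)%E)//.
  rewrite -E1 -E2; congr (fine (_ - _)%E); apply: eq_integral => t _.
    by rewrite funeposE /funrpos/= EFin_max.
  by rewrite funenegE /funrneg/= EFin_max EFinN.
apply: cvg_trans (cvgB h1 h2); apply: near_eq_cvg; near=> n.
rewrite /series/= -[LHS]/(\sum_(0 <= k < n) (w k)%:num * (h^\+)%R (x k) -
  \sum_(0 <= k < n) (w k)%:num * (h^\-)%R (x k)) -sumrB.
by apply: eq_bigr => k _; rewrite -mulrBr -{3}(funrposBneg h).
Unshelve. all: by end_near. Qed.

End DiracSeries.

(** * Jumps along the critical orbit *)

Section EventuallyPeriodicOrbit.
Context {R : realType}.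
Variables (f : R -> R) (c : R) (n0 n1 : nat).
Hypotheses (n0_gt0 : (0 < n0)%N) (per : min_period f (iter n0 f c) n1).
Hypothesis (nper : forall m, (0 < m < n0)%N -> ~ Defs.periodic f (iter m f c)).

Lemma iter_add_eq k i j : iter i f c = iter j f c -> iter (k + i) f c = iter (k + j) f c.
Proof. by rewrite !iterD => ->. Qed.

Lemma iter_eq_periodic i j : (i < j)%N -> iter i f c = iter j f c ->
  Defs.periodic f (iter i f c).
Proof.
by move=> ij E; exists (j - i)%N; rewrite ?subn_gt0// -iterD subnK ?E// ltnW.
Qed.

Let n1_gt0 : (0 < n1)%N. Proof. by case: per. Qed.

Lemma orbit_period k : (n0 <= k)%N -> iter (k + n1) f c = iter k f c.
Proof.
move=> n0k; have [_ E _] := per; rewrite -iterD in E.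
have -> : (k + n1 = (k - n0) + (n1 + n0))%N by lia.
by rewrite (iter_add_eq _ _ n0 E) subnK.
Qed.

Lemma orbit_period_mul k i : (n0 <= k)%N -> iter (k + i * n1) f c = iter k f c.
Proof.
move=> n0k; elim: i => [|i IHi]; first by rewrite addn0.
by rewrite mulSn addnCA addnC orbit_period// (leq_trans n0k)// leq_addr.
Qed.

(** If c_i = c_j with [i < j], then c_i is periodic, so [n0 <= i]. Applying [f] another
    [n0 + n1 - j] times shows that c_(n0) returns after [i + n1 - j < n1] steps, against
    minimality. *)
Lemma orbit_inj i j : (0 < i)%N -> (0 < j)%N -> (i < n0 + n1)%N -> (j < n0 + n1)%N ->
  iter i f c = iter j f c -> i = j.
Proof.
wlog ij : i j / (i < j)%N.
  move=> H i0 j0 iN jN E; case: (ltngtP i j) => // h.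
    exact: H.
  by apply/esym; apply: H.
move=> i0 _ iN jN E; exfalso.
have n0i : (n0 <= i)%N.
  rewrite leqNgt; apply/negP => h; apply: (nper i); first by rewrite i0.
  exact: iter_eq_periodic ij E.
have [_ _ mn] := per; apply: (mn (i + n1 - j)%N); first by lia.
rewrite -iterD -(_ : (n0 + n1 - j + i)%N = (i + n1 - j + n0)%N); last by lia.
rewrite (iter_add_eq _ _ _ E) (_ : (_ + j)%N = (n0 + n1)%N); last by lia.
exact: orbit_period.
Qed.

Lemma orbit_reduce m : (0 < m)%N -> exists m', [/\ (0 < m')%N, (m' < n0 + n1)%N &
  iter m' f c = iter m f c].
Proof.
move=> m0; have [mn0|n0m] := ltnP m n0.
  by exists m; split => //; rewrite (leq_trans mn0)// leq_addr.
exists (n0 + (m - n0) %% n1)%N; split.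
- by rewrite addn_gt0 n0_gt0.
- by rewrite ltn_add2l ltn_pmod.
rewrite -(orbit_period_mul _ ((m - n0) %/ n1)) ?leq_addr//.
by congr (iter _ f c); have := divn_eq (m - n0) n1; lia.
Qed.

End EventuallyPeriodicOrbit.

(** A return of [f c] to itself is carried to a return of [c] by [n1 - 1] further iterations. *)
Lemma min_period_image {R : realType} (f : R -> R) (c : R) n1 :
  min_period f c n1 -> min_period f (f c) n1.
Proof.
move=> [n10 E mn]; split => //; first by rewrite -iterSr iterS E.
move=> m /andP[m0 mn1]; rewrite -iterSr => H; apply: (mn m); first by rewrite m0.
have := iter_add_eq f c (n1.-1) m.+1 1 H.
rewrite (_ : (_ + 1)%N = n1) ?E; last by lia.
rewrite (_ : (_ + m.+1)%N = (m + n1)%N); last by lia.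
by rewrite iterD E.
Qed.

(** * The recursion for the jumps and the telescoping of the twisted equation *)

Section CriticalOrbit.
Context {R : realType}.
Variables (a c b : R) (f rho : R -> R) (r : nat).
Hypotheses (r0 : (0 < r)%N) (hf : unimodal r a c b f).
Hypothesis hrho : invariant_density a b f rho.

Local Notation d := (deriv_in `[a, b] f).
Local Notation J := (jump_at rho).
Local Notation s := (jump f c rho).

Let ac : a < c. Proof. by case/andP: (uni_turning hf). Qed.
Let cb : c < b. Proof. by case/andP: (uni_turning hf). Qed.

Lemma orbit_itv n : iter n f c \in `[a, b].
Proof.
elim: n => [|n IHn]; first by rewrite in_itv/= !ltW.
exact: (uni_self hf).
Qed.

Lemma jump_two_preimages x z : x \in `[a, b] -> z \in `[a, b] -> x != c -> z != c ->
  x != z -> f x = f z -> J (f x) = J x / d x + J z / d z.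
Proof.
wlog xc : x z / x < c.
  move=> H xab zab xc zc xz fxz; have [xc'|cx] := ltP x c; first exact: H.
  have {}cx : c < x by rewrite lt_neqAle eq_sym xc.
  have [zc'|cz] := ltP z c.
    by rewrite fxz addrC; apply: H => //; rewrite eq_sym.
  exfalso; move: xab zab; rewrite !in_itv/= => /andP[_ xb] /andP[_ zb].
  move: xz; rewrite neq_lt => /orP[xz|zx].
    by have := uni_decreasing hf (ltW cx) xz zb; rewrite fxz ltxx.
  by have := uni_decreasing hf cz zx xb; rewrite fxz ltxx.
rewrite !in_itv/= => /andP[ax xb] /andP[az zb] _ zc xz fxz.
apply: (jump_transfer _ _ _ _ _ _ r0 hf hrho) => //; first by rewrite ax.
rewrite zb andbT ltNge; apply/negP => zc'.
move: xz; rewrite neq_lt => /orP[xz|zx].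
  by have := uni_increasing hf ax xz zc'; rewrite fxz ltxx.
by have := uni_increasing hf az zx (ltW xc); rewrite fxz ltxx.
Qed.

Lemma other_preimage x : x \in `[a, b] -> x != c ->
  exists z, [/\ z \in `[a, b], z != c, x != z & f x = f z].
Proof.
move=> xab xc; have fxc := unimodal_lt_top _ _ _ _ _ hf _ xab xc.
have [|x1 [x2 [/andP[ax1 x1c] /andP[cx2 x2b] fx1 fx2]]] := unimodal_preimages _ _ _ _ _ hf (f x).
  by have := uni_self hf xab; rewrite fxc in_itv/= => /andP[->].
have [xc'|cx] := ltP x c.
  exists x2; split => //; first by rewrite in_itv/= x2b ltW// (lt_trans ac).
    by rewrite gt_eqF.
  by rewrite lt_eqF// (lt_trans xc').
exists x1; split => //; first by rewrite in_itv/= ax1 ltW// (lt_trans x1c).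
  by rewrite lt_eqF.
by rewrite gt_eqF// (lt_le_trans x1c).
Qed.

(** The second preimage of c_(n+1) differs from [c] and from c_n. By the assumption it is not
    postcritical, so it carries no jump. *)
Lemma jump_step n : iter n f c != c ->
  (forall m, (0 < m)%N -> iter m f c != c -> iter m f c != iter n f c ->
    iter m.+1 f c <> iter n.+1 f c) ->
  s n.+1 = s n / d (iter n f c).
Proof.
move=> nc H; have [z [zab zc xz fxz]] := other_preimage _ (orbit_itv n) nc.
have := jump_two_preimages _ _ (orbit_itv n) zab nc zc xz fxz.
rewrite (jump_not_postcritical _ _ _ _ _ _ r0 hf hrho z zab) ?mul0r ?addr0// => -[m m0 mz].
move: zc xz fxz; rewrite -mz eq_sym => zc xz fxz.
apply: (H m m0) => //; first by rewrite eq_sym.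
by rewrite eq_sym.
Qed.

(** Both preimages lie on the orbit, as happens where a strictly preperiodic orbit enters its
    cycle. *)
Lemma jump_merge n m : iter n f c != c -> iter m f c != c ->
  iter n f c != iter m f c -> iter n.+1 f c = iter m.+1 f c ->
  s n.+1 = s n / d (iter n f c) + s m / d (iter m f c).
Proof. by move=> nc mc nm E; apply: jump_two_preimages => //; exact: orbit_itv. Qed.

(** The coefficient of X(c_n) in the inner sums of [Psi1]. It agrees with s_n as long as no two
    orbit points merge. *)
Definition sigma n := s 1 / deriv_iter a b f n.-1 (f c).

Lemma sigma1 : sigma 1 = s 1.
Proof. by rewrite /sigma /deriv_iter big_ord0 divr1. Qed.

Lemma sigmaS n : (0 < n)%N -> sigma n.+1 = sigma n / d (iter n f c).
Proof.
case: n => // n _; rewrite /sigma /deriv_iter/= big_ord_recr/= invfM mulrA.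
by rewrite -iterSr.
Qed.

Lemma sigma_geometric : (forall k, (0 < k)%N -> iter k f c != c) ->
  exists2 q, 0 < q < 1 & forall n, `|sigma n.+1| <= `|s 1| * q ^+ n.
Proof.
move=> kc; have [lam lam1 Hd] := unimodal_deriv_expanding _ _ _ _ _ r0 hf.
have lam0 : 0 < lam by exact: lt_trans lam1.
exists lam^-1; first by rewrite invr_gt0 lam0 invf_lt1.
elim=> [|n IHn]; first by rewrite sigma1 expr0 mulr1.
rewrite sigmaS// exprSr mulrA normrM normfV; apply: ler_pM => //.
have [_ l] := Hd _ (orbit_itv n.+1) (kc n.+1 isT).
by rewrite lef_pV2// posrE// (lt_le_trans lam0).
Qed.

Lemma deriv_orbit_neq0 k : iter k f c != c -> d (iter k f c) != 0.
Proof.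
move=> kc; have [lam lam1 Hd] := unimodal_deriv_expanding _ _ _ _ _ r0 hf.
have [_ l] := Hd _ (orbit_itv k) kc.
by rewrite -normr_gt0 (lt_le_trans _ l)// (lt_trans _ lam1).
Qed.

(** Multiplying the twisted equation at c_n by sigma_(n+1) = sigma_n / f'(c_n) makes its right-hand
    side a difference of consecutive terms. Only indices below [n] must avoid [c]: the periodic case
    needs c_n = c. *)
Lemma twisted_telescope X alpha n : bounded_tce a c b f X alpha ->
  (0 < n)%N -> (forall k, (0 < k < n)%N -> iter k f c != c) ->
  \sum_(1 <= k < n.+1) sigma k * X (iter k f c) =
    s 1 * (X (f c) - alpha (f c)) + sigma n * alpha (iter n f c).
Proof.
move=> [_ _ tce]; elim: n => // -[_ _ _|n IHn _ kc].
  by rewrite big_nat1 sigma1 /= mulrBr subrK.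
rewrite big_nat_recr//= IHn// => [|k /andP[k0 kn]]; last by apply: kc; rewrite k0 ltnW.
have nc : iter n.+1 f c != c by apply: kc; rewrite !ltnS leqnn.
have /= -> := tce _ (orbit_itv n.+1) nc.
have /= d0 := deriv_orbit_neq0 _ nc; rewrite (sigmaS n.+1)//=.
move: (d _) d0 (sigma _) (alpha (f c)) (alpha _) (alpha _) (X _) => D D0 S A1 A2 A3 X1.
by field.
Qed.

End CriticalOrbit.

(** * Sums over the critical orbit *)

Section Series.
Context {R : realType}.
Implicit Type u : nat -> R.

Lemma series_from1 u : u 0 = 0 -> series u = fun n => \sum_(1 <= k < n) u k.
Proof.
move=> u0; apply/funext => -[|n]; first by rewrite /series/= !big_geq.
by rewrite /series/= big_ltn// u0 add0r.
Qed.

Lemma is_cvg_sum_geometric u (K q : R) : 0 < q < 1 ->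
  (forall n, `|u n.+1| <= K * q ^+ n) -> cvgn (fun n => \sum_(1 <= k < n) u k).
Proof.
move=> /andP[q0 q1] uK; have K0 : 0 <= K.
  by have := uK 0; rewrite expr0 mulr1; exact: le_trans.
have : cvgn (series (fun k => u k.+1)).
  apply: normed_cvg; apply: (@series_le_cvg _ _ (geometric K q)).
  - by move=> n; exact: normr_ge0.
  - by move=> n; rewrite mulr_ge0// exprn_ge0// ltW.
  - exact: uK.
  - by apply: is_cvg_geometric_series; rewrite ger0_norm// ltW.
move=> /cvg_ex[l hl]; apply/cvg_ex; exists l; rewrite -cvg_shiftS.
apply: cvg_trans hl; apply: near_eq_cvg; near=> n.
by rewrite /series/= big_add1.
Unshelve. all: by end_near. Qed.

(** Used along the indices [n0 + i * n1], which mark whole turns around a cycle. *)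
Lemma cvg_subseq_ge u (p : nat -> nat) (l : R) : (forall n, (n <= p n)%N) ->
  u @ \oo --> l -> u \o p @ \oo --> l.
Proof.
move=> np ul; apply: (@cvg_comp _ _ _ p u _ _ _ _ ul) => P [N _ NP].
by exists N => // n /= Nn; apply: NP; exact: leq_trans (np n).
Qed.

End Series.

(** * Integrals against the salient measure as sums over the critical orbit *)

Section SalientMeasure.
Context {R : realType}.
Variables (a c b : R) (f rho : R -> R) (r : nat).
Hypothesis hf : unimodal r a c b f.
Variables (N : option nat) (h : R -> R) (B : R).
Hypothesis hB : forall n, `|h (iter n f c)| <= B.

(** The positive and negative parts of the weights are treated separately and recombined. The
    measure series starts at index [0], where the weight is [0], so the sum may start at [1]. *)
Lemma cvg_int_sal' : cvgn (fun n => \sum_(1 <= k < n) `|sal_weight f c N rho k|) ->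
  (fun n => \sum_(1 <= k < n) sal_weight f c N rho k * h (iter k f c)) @ \oo -->
  int_sal' f c N rho `[a, b] h.
Proof.
move=> cw; set w := sal_weight f c N rho.
have w0 : w 0 = 0 by [].
have cw' : cvgn (series (fun k => `|w k|)) by rewrite series_from1// w0 normr0.
have part (v : nat -> R) : (forall n, `|v n| = `|w n|) ->
    cvgn (series (fun k => (pos_part (v k))%:num)).
  move=> vw; apply: (@series_le_cvg _ _ (fun k => `|w k|)) => // n.
  by rewrite -vw /= ge_max ler_norm normr_ge0.
have Dx n : `[a, b]%classic (iter n f c) by exact: (orbit_itv _ _ _ _ _ hf).
have h1 := Rintegral_dirac_series (fun n => pos_part (w n)) (fun n => iter n f c)
  `[a, b] (measurable_itv _) Dx h B hB (part w (fun _ => erefl)).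
have h2 := Rintegral_dirac_series (fun n => pos_part (- w n)) (fun n => iter n f c)
  `[a, b] (measurable_itv _) Dx h B hB (part (fun n => - w n) (fun n => normrN _)).
rewrite -(series_from1 (fun k => w k * h (iter k f c))); last by rewrite w0 mul0r.
apply: cvg_trans (cvgB h1 h2); apply: near_eq_cvg; near=> n.
rewrite /series/= -[LHS]/(\sum_(0 <= k < n) Num.max (w k) 0 * h (iter k f c) -
  \sum_(0 <= k < n) Num.max (- w k) 0 * h (iter k f c)) -sumrB.
apply: eq_bigr => k _; rewrite -mulrBl; congr (_ * _).
by have [wk|wk] := leP (w k) 0; [rewrite max_l ?oppr_ge0// sub0r opprK|
  rewrite max_r ?subr0// oppr_le0 ltW].
Unshelve. all: by end_near. Qed.

Lemma int_sal'_finite n : N = Some n ->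
  int_sal' f c N rho `[a, b] h = \sum_(1 <= k < n.+1) jump f c rho k * h (iter k f c).
Proof.
move=> NE.
(* Weights vanish past [n], so partial sums stabilize; [v] stands for the absolute value of the
   weight and then for the product. *)
have tail (v : R -> R -> R) m : (forall y, v 0 y = 0) -> (n < m)%N ->
    \sum_(1 <= k < m) v (sal_weight f c N rho k) (h (iter k f c)) =
    \sum_(1 <= k < n.+1) v (jump f c rho k) (h (iter k f c)).
  move=> v0 nm; rewrite (big_cat_nat (n := n.+1))//= [X in _ + X]big_nat_cond.
  rewrite [X in _ + X]big1 ?addr0; last first.
    move=> k /andP[/andP[nk _] _]; rewrite /sal_weight NE.
    by rewrite [(k <= n)%N]leqNgt nk andbF.
  rewrite big_nat_cond [RHS]big_nat_cond; apply: eq_bigr => k /andP[/andP[k0 kn] _].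
  by rewrite /sal_weight NE k0 -ltnS kn.
have cw : cvgn (fun m => \sum_(1 <= k < m) `|sal_weight f c N rho k|).
  apply/cvg_ex; exists (\sum_(1 <= k < n.+1) `|jump f c rho k|).
  apply: cvg_near_cst; near=> m.
  by apply: (tail (fun x _ => `|x|)) => [y|]; [exact: normr0|near: m; exact: nbhs_infty_gt].
rewrite -(cvg_lim (@Rhausdorff R) (cvg_int_sal' cw)).
apply: cvg_lim; first exact: Rhausdorff.
apply: cvg_near_cst; near=> m.
by apply: (tail *%R) => [y|]; [exact: mul0r|near: m; exact: nbhs_infty_gt].
Unshelve. all: by end_near. Qed.

Lemma int_sal'_infinite (K q : R) : N = None -> 0 < q < 1 ->
  (forall n, `|jump f c rho n.+1| <= K * q ^+ n) ->
  limn (fun n => \sum_(1 <= k < n) jump f c rho k * h (iter k f c)) =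
  int_sal' f c N rho `[a, b] h.
Proof.
move=> NE q01 jK; apply: cvg_lim; first exact: Rhausdorff.
have wE k : (0 < k)%N -> sal_weight f c N rho k = jump f c rho k.
  by move=> k0; rewrite /sal_weight NE k0.
apply: cvg_trans (cvg_int_sal' _).
  apply: near_eq_cvg; near=> n.
  by rewrite big_nat_cond [RHS]big_nat_cond; apply: eq_bigr => k /andP[/andP[k0 _] _]; rewrite wE.
by apply: (is_cvg_sum_geometric _ K q q01) => n; rewrite normr_id wE.
Unshelve. all: by end_near. Qed.

End SalientMeasure.

(** * Periodic and infinite critical orbits *)

Section Main.
Context {R : realType}.
Variables (a c b : R) (f rho X phi alpha : R -> R) (r : nat).
Hypotheses (r0 : (0 < r)%N) (hf : unimodal r a c b f).
Hypothesis hrho : invariant_density a b f rho.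
Hypothesis tce : bounded_tce a c b f X alpha.
Variables B : R.
Hypothesis hB : forall n, `|alpha (iter n f c) * phi (iter n f c)| <= B.

Local Notation s := (jump f c rho).
Local Notation sigma := (sigma a c b f rho).
Local Notation D := (s 1 * (X (f c) - alpha (f c))).

Let g x := alpha x * phi x.

Lemma inner_sum j : D = 0 -> (0 < j)%N -> (forall k, (0 < k < j)%N -> iter k f c != c) ->
  phi (iter j f c) * (\sum_(1 <= k < j.+1)
      s 1 * X (iter k f c) / deriv_iter a b f k.-1 (f c)) = sigma j * g (iter j f c).
Proof.
move=> D0 j0 kc; under eq_bigr do rewrite mulrAC.
rewrite (twisted_telescope _ _ _ _ _ _ r0 hf _ _ _ tce j0 kc) D0 add0r /g.
by rewrite mulrC -mulrA.
Qed.

(** Here s_k = sigma_k up to [n1], and [alpha] vanishes at c_(n1) = c, so [calJ] telescopes exactly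
    to [D]. *)
Lemma Psi1_periodic n1 : min_period f c n1 -> calJ f c (Some n1) rho X = 0 ->
  osum (Some n1) (fun j => phi (iter j f c) *
    \sum_(1 <= k < j.+1) s 1 * X (iter k f c) / deriv_iter a b f k.-1 (f c)) =
  int_sal' f c (Some n1) rho `[a, b] g.
Proof.
move=> per; have [n10 cE mn] := per.
(* The cycle is read from c_1, with preperiod [1], to match sums starting at index [1]. *)
have per1 : min_period f (iter 1 f c) n1 by exact: min_period_image.
have np1 m : (0 < m < 1)%N -> ~ Defs.periodic f (iter m f c) by case: m.
have inj := orbit_inj _ _ 1 n1 isT per1 np1.
have kc k : (0 < k < n1)%N -> iter k f c != c by move=> /mn/eqP.
have sE k : (0 < k <= n1)%N -> s k = sigma k.
  elim: k => // -[_ _|k IHk /andP[_ kn]]; first by rewrite sigma1.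
  rewrite (sigmaS _ _ _ _ _ k.+1)// -IHk ?(ltnW kn)//.
  apply: (jump_step _ _ _ _ _ _ r0 hf hrho); first by rewrite kc.
  move=> m m0 mc mk E.
  have [m' [m'0 m'n mE]] := orbit_reduce _ _ 1 n1 isT per1 m m0.
  have m'n1 : (m' < n1)%N.
    rewrite ltn_neqAle -ltnS m'n andbT; apply/eqP => E'.
    by move: mc; rewrite -mE E' cE eqxx.
  have : m'.+1 = k.+2 by apply: inj => //; rewrite iterS mE.
  by case=> m'k; move: mk; rewrite -mE m'k eqxx.
have sumE (h : R -> R) : \sum_(1 <= k < n1.+1) s k * h (iter k f c) =
    \sum_(1 <= k < n1.+1) sigma k * h (iter k f c).
  by rewrite big_nat_cond [RHS]big_nat_cond; apply: eq_bigr => k /andP[k0 _]; rewrite sE.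
rewrite /calJ/= sumE (twisted_telescope _ _ _ _ _ _ r0 hf _ _ _ tce n10 kc) cE.
have [_ -> _] := tce; rewrite mulr0 addr0 => D0.
rewrite (int_sal'_finite a c b f rho r hf (Some n1) g B hB n1 erefl) sumE.
rewrite big_nat_cond [RHS]big_nat_cond; apply: eq_bigr => k /andP[/andP[k0 kn] _].
apply: inner_sum => // i /andP[i0 ik]; apply: kc; rewrite i0.
by rewrite (leq_trans ik).
Qed.

Lemma orbit_avoids : ~ Defs.periodic f c -> forall k, (0 < k)%N -> iter k f c != c.
Proof. by move=> np k k0; apply/eqP => E; apply: np; exists k. Qed.

Lemma sum_infinite : D = 0 -> (forall k, (0 < k)%N -> iter k f c != c) ->
  (fun n => \sum_(1 <= j < n) phi (iter j f c) *
    \sum_(1 <= k < j.+1) s 1 * X (iter k f c) / deriv_iter a b f k.-1 (f c)) =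
  (fun n => \sum_(1 <= j < n) sigma j * g (iter j f c)).
Proof.
move=> D0 kc; apply/funext => n; rewrite big_nat_cond [RHS]big_nat_cond.
apply: eq_bigr => k /andP[/andP[k0 kn] _].
by apply: inner_sum => // i /andP[i0 _]; exact: kc.
Qed.

(** The remainder sigma_n alpha(c_n) tends to [0]: expansion makes [sigma] decay geometrically, and
    [alpha] is bounded. *)
Lemma cvg_telescope : (forall k, (0 < k)%N -> iter k f c != c) ->
  (fun n => \sum_(1 <= k < n) sigma k * X (iter k f c)) @ \oo --> D.
Proof.
move=> kc; have [q /andP[q0 q1] sq] := sigma_geometric _ _ _ _ rho _ r0 hf kc.
have [[A HA] _ _] := tce.
have z : (fun n => sigma n.+1 * alpha (iter n.+1 f c)) @ \oo --> 0.
  apply/cvgr0Pnorm_le => e e0.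
  have /cvgr0Pnorm_le/(_ e e0) : geometric (`|s 1| * A) q @ \oo --> 0.
    by apply: cvg_geometric; rewrite ger0_norm// ltW.
  apply: filterS => n; apply: le_trans; rewrite normrM.
  apply: le_trans (ler_norm _).
  rewrite /= mulrAC; apply: ler_pM => //.
  exact: HA (orbit_itv _ _ _ _ _ hf n.+1).
rewrite -cvg_shiftS -cvg_shiftS.
have : (fun n => D + sigma n.+1 * alpha (iter n.+1 f c)) @ \oo --> D + 0.
  by apply: cvgD => //; exact: cvg_cst.
rewrite addr0; apply: cvg_trans; apply: near_eq_cvg; near=> n.
rewrite [RHS](twisted_telescope _ _ _ _ _ _ r0 hf _ _ n.+1 tce)// => k /andP[k0 _].
exact: kc.
Unshelve. all: by end_near. Qed.

(** Two equal iterates would produce a periodic point, so no two orbit points merge and s_n =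
    sigma_n throughout; [calJ] is then the limit [D]. *)
Lemma Psi1_infinite : (forall m, ~ Defs.periodic f (iter m f c)) ->
  calJ f c None rho X = 0 ->
  osum None (fun j => phi (iter j f c) *
    \sum_(1 <= k < j.+1) s 1 * X (iter k f c) / deriv_iter a b f k.-1 (f c)) =
  int_sal' f c None rho `[a, b] g.
Proof.
move=> np; have kc := orbit_avoids (np 0).
have [q q01 sq] := sigma_geometric _ _ _ _ rho _ r0 hf kc.
have sE k : s k.+1 = sigma k.+1.
  elim: k => [|k IHk]; first by rewrite sigma1.
  rewrite (sigmaS _ _ _ _ _ k.+1)// -IHk.
  apply: (jump_step _ _ _ _ _ _ r0 hf hrho); first by rewrite kc.
  move=> m m0 mc mk E.
  have mk' : m != k.+1 by apply: contra mk => /eqP->.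
  move: mk'; rewrite neq_ltn => /orP[h|h].
    by apply: (np m.+1); apply: (iter_eq_periodic _ _ m.+1 k.+2).
  by apply: (np k.+2); apply: (iter_eq_periodic _ _ k.+2 m.+1).
have sumE (h : R -> R) : (fun n => \sum_(1 <= k < n) s k * h (iter k f c)) =
    (fun n => \sum_(1 <= k < n) sigma k * h (iter k f c)).
  apply/funext => n; rewrite big_nat_cond [RHS]big_nat_cond.
  by apply: eq_bigr => -[|k] // _; rewrite sE.
rewrite /calJ/= sumE (cvg_lim (@Rhausdorff R) (cvg_telescope kc)) => D0.
rewrite sum_infinite// -sumE.
apply: (int_sal'_infinite a c b f rho r hf None g B hB `|s 1| q) => // n.
by rewrite sE.
Qed.

End Main.

(** * The preperiodic case *)

Section Preperiodic.
Context {R : realType}.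
Variables (a c b : R) (f rho : R -> R) (r n0 n1 : nat).
Hypotheses (r0 : (0 < r)%N) (hf : unimodal r a c b f).
Hypothesis hrho : invariant_density a b f rho.
Hypotheses (npc : ~ Defs.periodic f c)
  (np : forall m, (m < n0)%N -> ~ Defs.periodic f (iter m f c))
  (per : min_period f (iter n0 f c) n1).

Local Notation d := (deriv_in `[a, b] f).
Local Notation s := (jump f c rho).
Local Notation sigma := (sigma a c b f rho).

Let n1_gt0 : (0 < n1)%N. Proof. by case: per. Qed.

Let kc k : (0 < k)%N -> iter k f c != c.
Proof. by move=> k0; apply/eqP => E; apply: npc; exists k. Qed.

(** If [n0 = 1], then c_(n1) has the same image as [c], yet only [c] attains the maximum [f c].
    Hence the point preceding the cycle has a positive index. *)
Lemma preperiod_gt1 : (1 < n0)%N.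
Proof.
have [_ E _] := per; move: E; case: n0 => [|[|//]] E; exfalso.
  by apply: npc; exists n1.
have /eqP := kc _ n1_gt0; apply.
apply/eqP; apply/negP => /negP h.
have := unimodal_lt_top _ _ _ _ _ hf _ (orbit_itv _ _ _ _ _ hf n1) h.
by rewrite -iterS iterSr E ltxx.
Qed.

Let n0_gt0 : (0 < n0)%N. Proof. exact: ltnW preperiod_gt1. Qed.

Let inj := orbit_inj f c n0 n1 n0_gt0 per
  (fun m (h : (0 < m < n0)%N) => np m (proj2 (andP h))).

(** Among positive indices below [n0 + n1], the only two orbit points with a common image are those
    mapping to c_(n0), which [k.+1 != n0] excludes. *)
Let jump_stepE k : (0 < k)%N -> (k.+1 < n0 + n1)%N -> k.+1 != n0 ->
  s k.+1 = s k / d (iter k f c).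
Proof.
move=> k0 kN kn0; apply: (jump_step _ _ _ _ _ _ r0 hf hrho); first exact: kc.
move=> m m0 mc mk E.
have [m' [m'0 m'N mE]] := orbit_reduce _ _ n0 n1 n0_gt0 per m m0.
have E' : iter m'.+1 f c = iter k.+1 f c by rewrite iterS mE.
have [m'1|] := ltnP m'.+1 (n0 + n1).
  have [m'k] : m'.+1 = k.+1 by exact: inj.
  by move: mk; rewrite -mE m'k eqxx.
move=> Nm'; have m'E : m'.+1 = (n0 + n1)%N by lia.
move: E'; rewrite m'E (orbit_period _ _ n0 n1 n0_gt0 per) ?leqnn// => E'.
have := inj n0 k.+1 n0_gt0 isT _ kN E'.
by rewrite -[X in (X < _)%N]addn0 ltn_add2l n1_gt0 => /(_ isT) h; move: kn0; rewrite h eqxx.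
Qed.

Let jump_preperiod k : k.+1 = n0 ->
  s k.+1 = s k / d (iter k f c) +
           s (n0 + n1).-1 / d (iter (n0 + n1).-1 f c).
Proof.
move=> kE; have k0 : (0 < k)%N by have := preperiod_gt1; lia.
apply: (jump_merge _ _ _ _ _ _ r0 hf hrho).
- exact: kc.
- by apply: kc; lia.
- by apply/eqP => /inj; lia.
rewrite prednK ?addn_gt0 ?n0_gt0// (orbit_period _ _ n0 n1 n0_gt0 per) ?leqnn//.
by rewrite kE.
Qed.

(** The derivative of f^i at c_(n0); [p] is thus the multiplier of the cycle. *)
Let P i := \prod_(j < i) d (iter (n0 + j) f c).

Let PS i : P i.+1 = P i * d (iter (n0 + i) f c).
Proof. by rewrite /P big_ord_recr. Qed.

Let p := P n1.

Let p_gt1 : 1 < `|p|.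
Proof.
have [lam lam1 Hd] := unimodal_deriv_expanding _ _ _ _ _ r0 hf.
have lam0 : 0 < lam by exact: lt_trans lam1.
suff H i : lam ^+ i <= `|P i|.
  by apply: lt_le_trans (H n1); rewrite exprn_egt1// -lt0n.
elim: i => [|i IHi]; first by rewrite /P big_ord0 normr1 expr0.
rewrite PS normrM exprSr; apply: ler_pM => //; [by rewrite exprn_ge0// ltW|exact: ltW|].
by apply: (Hd _ (orbit_itv _ _ _ _ _ hf _) _).2; apply: kc; rewrite addn_gt0 n0_gt0.
Qed.

Lemma jump_transient k : (0 < k < n0)%N -> s k = sigma k.
Proof.
elim: k => // -[_ _|k IHk /andP[_ kn0]]; first by rewrite sigma1.
rewrite (sigmaS _ _ _ _ _ k.+1)// -IHk ?(ltnW kn0)//.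
by apply: jump_stepE => //; [rewrite ltn_addr|rewrite neq_ltn kn0].
Qed.

Let jump_cycle i : (i < n1)%N -> s (n0 + i)%N = s n0 / P i.
Proof.
elim: i => [_|i IHi iN]; first by rewrite addn0 /P big_ord0 divr1.
rewrite addnS jump_stepE; first by rewrite (IHi (ltnW iN)) PS invfM mulrA.
- by rewrite addn_gt0 n0_gt0.
- by rewrite -addnS ltn_add2l.
- by rewrite neq_ltn ltnS leq_addr orbT.
Qed.

Let sigma_cycle i : sigma (n0 + i)%N = sigma n0 / P i.
Proof.
elim: i => [|i IHi]; first by rewrite addn0 /P big_ord0 divr1.
by rewrite addnS sigmaS ?addn_gt0 ?n0_gt0// IHi PS invfM mulrA.
Qed.

(* The first return to [c_(n0)] feeds back a fraction [1 / p] of the jump. *)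
Let jump_return : s n0 * (1 - p^-1) = sigma n0.
Proof.
have n0E : n0.-1.+1 = n0 by rewrite prednK.
have := jump_preperiod _ n0E; rewrite n0E.
have -> : (n0 + n1).-1 = (n0 + n1.-1)%N by lia.
rewrite jump_cycle ?prednK// (jump_transient n0.-1); last by have := preperiod_gt1; lia.
rewrite -sigmaS; last by have := preperiod_gt1; lia.
rewrite n0E -mulrA -invfM -PS prednK// -/p => E.
by rewrite mulrBr mulr1 {1}E addrK.
Qed.

Let sigma_jump i : (i < n1)%N -> sigma (n0 + i)%N = s (n0 + i)%N * (1 - p^-1).
Proof. by move=> iN; rewrite sigma_cycle jump_cycle// -jump_return mulrAC. Qed.

Let sigma_period k : (n0 <= k)%N -> sigma (k + n1)%N = sigma k / p.
Proof.
move=> n0k; rewrite -(subnKC n0k); elim: (k - n0)%N => [|i IHi].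
  by rewrite addn0 sigma_cycle.
have q0 : (0 < n0 + i)%N by rewrite addn_gt0 n0_gt0.
rewrite addnS addSn (sigmaS _ _ _ _ _ (n0 + i + n1)) ?ltn_addr// IHi.
rewrite (sigmaS _ _ _ _ _ (n0 + i))// mulrAC.
by rewrite (orbit_period _ _ n0 n1 n0_gt0 per) ?leq_addr.
Qed.

Let sigma_period_mul k i : (n0 <= k)%N -> sigma (k + i * n1)%N = sigma k / p ^+ i.
Proof.
move=> n0k; elim: i => [|i IHi]; first by rewrite addn0 expr0 divr1.
rewrite mulSn addnCA addnC sigma_period; last by rewrite (leq_trans n0k)// leq_addr.
by rewrite IHi exprSr invfM mulrA.
Qed.

(** One turn around the cycle divides [sigma] by [p]. With [Q] the sum of the s-terms over the
    cycle, turn [i] contributes Q (1 - 1/p) / p^i by [sigma_jump], and these contributions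
    telescope. *)
Lemma sum_sigma_blocks (h : R -> R) i :
  \sum_(1 <= k < n0 + i * n1) sigma k * h (iter k f c) =
  \sum_(1 <= k < n0 + n1) s k * h (iter k f c) -
  (\sum_(n0 <= k < n0 + n1) s k * h (iter k f c)) / p ^+ i.
Proof.
elim: i => [|i IHi].
  rewrite addn0 expr0 divr1 [X in _ = X - _](big_cat_nat (n := n0))//= ?leq_addr//.
  rewrite addrK big_nat_cond [RHS]big_nat_cond.
  by apply: eq_bigr => k /andP[h01 _]; rewrite jump_transient.
rewrite (big_cat_nat (n := (n0 + i * n1)%N))/=; last 2 first.
- by rewrite addn_gt0 n0_gt0.
- by rewrite leq_add2l leq_mul2r leqnSn orbT.
rewrite IHi; set T := \sum_(1 <= k < _) _; set Q := \sum_(n0 <= k < _) _.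
have -> : \sum_(n0 + i * n1 <= k < n0 + i.+1 * n1) sigma k * h (iter k f c) =
    Q * (1 - p^-1) / p ^+ i.
  rewrite (_ : (n0 + i.+1 * n1)%N = (n0 + n1 + i * n1)%N); last by rewrite mulSn addnA.
  rewrite [LHS]big_addn addnK /Q !mulr_suml.
  rewrite big_nat_cond [RHS]big_nat_cond; apply: eq_bigr => k /andP[/andP[n0k kN] _].
  rewrite sigma_period_mul// (orbit_period_mul _ _ n0 n1 n0_gt0 per)//.
  have := sigma_jump (k - n0)%N; rewrite subnKC// => -> ; last by lia.
  by move: (s k) (h _) (p^-1) (p ^+ i)^-1 => x y z t; ring.
rewrite exprSr invfM; move: (p^-1) (p ^+ i)^-1 => x y; ring.
Qed.

(** Serves twice: [X] as [h] yields [calJ], and the product of [alpha] and [phi] yields the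
    integral. *)
Lemma cvg_sum_sigma_blocks (h : R -> R) :
  (fun i => \sum_(1 <= k < n0 + i * n1) sigma k * h (iter k f c)) @ \oo -->
  \sum_(1 <= k < n0 + n1) s k * h (iter k f c).
Proof.
have p1 : `|p^-1| < 1 by rewrite normfV invf_lt1// (lt_trans _ p_gt1).
pose Q := \sum_(n0 <= k < n0 + n1) s k * h (iter k f c).
pose T := \sum_(1 <= k < n0 + n1) s k * h (iter k f c).
have : (fun i => T - Q * p^-1 ^+ i) @ \oo --> T - Q * 0.
  apply: cvgB; first exact: cvg_cst.
  by apply: cvgM; [exact: cvg_cst|exact: cvg_expr].
rewrite mulr0 subr0; apply: cvg_trans; apply: near_eq_cvg; near=> i.
by rewrite sum_sigma_blocks exprVn.
Unshelve. all: by end_near. Qed.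

(** Along whole turns the sums of sigma_k X(c_k) tend to [D] by telescoping and to [calJ] by blocks,
    whence [D = 0]. *)
Lemma Psi1_preperiodic (X phi alpha : R -> R) (B : R) :
  bounded_tce a c b f X alpha ->
  (forall n, `|alpha (iter n f c) * phi (iter n f c)| <= B) ->
  calJ f c (Some (n0 + n1 - 1)%N) rho X = 0 ->
  osum None (fun j => phi (iter j f c) *
    \sum_(1 <= k < j.+1) s 1 * X (iter k f c) / deriv_iter a b f k.-1 (f c)) =
  int_sal' f c (Some (n0 + n1 - 1)%N) rho `[a, b] (fun x => alpha x * phi x).
Proof.
move=> tce hB; have NE : (n0 + n1 - 1).+1 = (n0 + n1)%N by lia.
have sub i : (i <= n0 + i * n1)%N.
  by rewrite (leq_trans _ (leq_addl _ _))// leq_pmulr.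
have cX := cvg_subseq_ge _ _ _ sub (cvg_telescope a c b f rho X alpha r r0 hf tce kc).
rewrite /calJ/= NE => J0.
have D0 : s 1 * (X (f c) - alpha (f c)) = 0.
  rewrite -(cvg_lim (@Rhausdorff R) cX) -[RHS]J0.
  by apply: cvg_lim; [exact: Rhausdorff|exact: cvg_sum_sigma_blocks].
rewrite (int_sal'_finite a c b f rho r hf _ _ B hB (n0 + n1 - 1)%N erefl) NE.
rewrite /osum (sum_infinite a c b f rho X phi alpha r r0 hf tce D0 kc).
have [q q01 sq] := sigma_geometric _ _ _ _ rho _ r0 hf kc.
(* Blocks only identify the limit along a subsequence, so convergence of the full series is
   established first. *)
have cg : cvgn (fun n => \sum_(1 <= k < n) sigma k * (alpha (iter k f c) * phi (iter k f c))).
  apply: (is_cvg_sum_geometric _ (B * `|s 1|) q q01) => n.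
  by rewrite normrM mulrC -mulrA; apply: ler_pM.
rewrite -(cvg_lim (@Rhausdorff R) (cvg_subseq_ge _ _ _ sub cg)).
by apply: cvg_lim; [exact: Rhausdorff|exact: (cvg_sum_sigma_blocks (fun x => alpha x * phi x))].
Qed.

End Preperiodic.

(** * Boundedness of the test function and assembly of the three cases *)

Lemma Ck_bounded {R : realType} (a b : R) (k : nat) (h : R -> R) : a <= b ->
  (0 < k)%N -> Ck k `[a, b] h ->
  exists B, forall x, x \in `[a, b] -> `|h x| <= B.
Proof.
move=> ab k0 [U [g [oU AU [gU _] gh]]].
have cg : {within `[a, b], continuous (fun x => `|g x|)}.
  apply: continuous_in_subspaceT => x xab; apply: continuous_comp.
    apply: differentiable_continuous; apply/derivable1_diffP.
    by apply: (gU 0 x k0); apply: AU; rewrite inE in xab.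
  exact: norm_continuous.
have [m _ gm] := EVT_max ab cg.
by exists `|g m| => x xab; rewrite -gh//; exact: gm.
Qed.

Theorem lemma4p4 (R : realType) (a c b : R) (f : R -> R)
    (hf : unimodal 3 a c b f) (hmix : mixing c f)
    (N M : option nat) (hNM : orbit_counts f c N M)
    (rho0 : R -> R) (hrho : invariant_density a b f rho0)
    (X : R -> R) (hX : Ck 2 `[a, f c] X) (hXa : X a = 0)
    (hJ : calJ f c N rho0 X = 0)
    (phi : R -> R) (hphi : Ck 1 `[a, b] phi)
    (alpha : R -> R) (halpha : bounded_tce a c b f X alpha) :
  Psi1 a c b f N M rho0 X phi =
    - int_sal' f c N rho0 `[a, b] (fun x => alpha x * phi x)
    - resolvent_term a c b f N rho0 X phi.
Proof.
rewrite /Psi1; congr (- _ - _).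
have ab : a <= b by case/andP: (uni_turning hf) => /lt_trans h /h /ltW.
have [[A HA] _ _] := halpha; have [B HB] := Ck_bounded _ _ 1 _ ab isT hphi.
have hB n : `|alpha (iter n f c) * phi (iter n f c)| <= A * B.
  have cn := orbit_itv _ _ _ _ _ hf n.
  by rewrite normrM; apply: ler_pM => //; [exact: HA|exact: HB].
case: hNM hJ => [n1 per|n0 n1 npc np per|np] J0.
- exact: (Psi1_periodic a c b f rho0 X phi alpha 3 isT hf hrho halpha (A * B) hB).
- exact: (Psi1_preperiodic a c b f rho0 3 n0 n1 isT hf hrho npc np per _ _ _ (A * B)).
- exact: (Psi1_infinite a c b f rho0 X phi alpha 3 isT hf hrho halpha (A * B) hB).
Qed.
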